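(* There is an ascending function $\Phi(h,d)$ of positive integers such that, for every algebraically closed field $K$, every $N$, and every form $F$ of degree $d$ in $K[x_1,\ldots,x_N]$ of strength at least $\Phi(h,d)$, the $K$-vector space $\mathcal{D}F$ is not contained in any ideal generated by $h$ forms of degree at most $d-1$.
   Context: For a form $F \in K[x_1,\ldots,x_N]$, $\mathcal{D}F$ denotes the $K$-span of the partial derivatives $\partial F/\partial x_i$, $1\le i\le N$. A nonzero form $F$ of positive degree has a $k$-collapse if it lies in an ideal generated by $k$ elements of strictly smaller positive degree; $F$ has strength $k$ if it has a $(k+1)$-collapse but no $k$-collapse; nonzero linear forms have strength $+\infty$. ''Strength at least $s$'' means no $s$-collapse. A function is ascending if it is nondecreasing in each argument.
   Formalization: The h forms generating the ideal are required to have positive degree (between 1 and d-1), since a nonzero constant form would generate the unit ideal, which contains DF; the claim is therefore vacuous for d = 1. *)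

(* Defs.v *)
(* Multivariate polynomials K[x_1..x_N] are built as iterated
   univariate polynomial rings: mpoly K 0 = K, mpoly K (n+1) = (mpoly K n)[x_{n+1}]. *)
From HB Require Import structures.
From mathcomp Require Import all_boot all_order all_algebra all_field.
Set Implicit Arguments. Unset Strict Implicit. Unset Printing Implicit Defensive.
Import GRing.Theory.
Local Open Scope ring_scope.

Fixpoint mpoly (K : comNzRingType) (n : nat) : comNzRingType :=
  match n with
  | 0 => K
  | n'.+1 => ({poly (mpoly K n')} : comNzRingType)
  end.

Fixpoint mconst (K : comNzRingType) (n : nat) : K -> mpoly K n :=
  match n return K -> mpoly K n with
  | 0 => fun c => c
  | n'.+1 => fun c => (mconst n' c)%:P
  end.

(* partial derivative with respect to the variable of index i (0-based);
   variable of index n' in mpoly K n'.+1 is the outermost 'X *)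
Fixpoint pderiv (K : comNzRingType) (n : nat) : nat -> mpoly K n -> mpoly K n :=
  match n return nat -> mpoly K n -> mpoly K n with
  | 0 => fun _ _ => 0
  | n'.+1 => fun i (p : {poly (mpoly K n')}) =>
      if i == n' then deriv p else map_poly (@pderiv K n' i) p
  end.

(* p is homogeneous of total degree d (the zero polynomial is homogeneous of
   every degree) *)
Fixpoint homog (K : comNzRingType) (n : nat) : nat -> mpoly K n -> Prop :=
  match n return nat -> mpoly K n -> Prop with
  | 0 => fun d c => d = 0%N \/ c = 0
  | n'.+1 => fun d (p : {poly (mpoly K n')}) =>
      forall j : nat, if (j <= d)%N then @homog K n' (d - j)%N p`_j else p`_j = 0
  end.

Definition in_ideal (R : comNzRingType) (k : nat) (g : 'I_k -> R) (f : R) : Prop :=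
  exists a : 'I_k -> R, f = \sum_(i < k) a i * g i.

Definition has_collapse (K : comNzRingType) (N d k : nat) (F : mpoly K N) : Prop :=
  exists (g : 'I_k -> mpoly K N),
    (forall i, exists e : nat, [/\ (0 < e)%N, (e < d)%N & homog e (g i)]) /\
    in_ideal g F.

Definition strength_ge (K : comNzRingType) (N d s : nat) (F : mpoly K N) : Prop :=
  ~ has_collapse d s F.

Definition in_DF (K : comNzRingType) (N : nat) (F v : mpoly K N) : Prop :=
  exists c : 'I_N -> K, v = \sum_(i < N) mconst N (c i) * pderiv i F.

Definition ascending2 (Phi : nat -> nat -> nat) : Prop :=
  forall h h' d d' : nat, (0 < h)%N -> (0 < d)%N -> (h <= h')%N -> (d <= d')%N ->
    (Phi h d <= Phi h' d')%N.

(* Main.v *)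
Require Import Defs.
From HB Require Import structures.
From mathcomp Require Import all_boot all_order all_algebra all_field.
From mathcomp Require Import ring boolp filter ring_quotient.
Set Implicit Arguments. Unset Strict Implicit. Unset Printing Implicit Defensive.
Import GRing.Theory.
Local Open Scope ring_scope.

(** If the characteristic of K does not divide d, Euler's formula puts F in the ideal
generated by its partial derivatives. So fix a prime p and suppose that there are
counterexamples F_s of characteristic p and strength at least s for every s. The
bounded degree part S of an ultraproduct of the polynomial rings is a graded domain over
a perfect field K, with commuting derivations D, and the class x of the F_s lies outside
the square of the maximal graded ideal S_+.

Homogeneous elements of S_+ that are linearly independent over K modulo S_+^2 are
algebraically independent. Take a relation f of minimal degree. If all its partial
derivatives vanish then f is a p-th power. Otherwise let X_j be a variable of largest
degree with df/dX_j nonzero; a translation moves a generator only by elements of lower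
degree, so df/dX_j is translation invariant, hence constant, and f expresses the j-th
generator by decomposable elements. Therefore S is a polynomial ring, and generators
e_1, ..., e_r span a prime ideal P.

Suppose that all D x lie in such a P with deg e_j < deg x. By induction on the degree the
vectors D e_1, ..., D e_r are linearly independent modulo P. Eliminating the e_j one at a
time, one finds w outside P and f0 congruent to w^p x modulo P with D f0 in
J = (e_1^p, ..., e_r^p) for all D. The Poincare lemma modulo J makes f0 a p-th power modulo
J. So w^p x is a p-th power modulo P, which is absurd since x is one of the variables of the
polynomial ring S / P. *)

(** * Evaluation and partial derivatives of polynomials *)

(** When p divides d, Euler's formula says nothing about F, and all derivatives of a p-th power
    vanish. In effect p-th powers are shown to be the only obstruction, and these are decomposable.
    The difficulty is that the derivations do not preserve P, so they do not act on S / P, where the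
    p-th root is wanted. They do preserve the ideal J of the p-th powers of the generators, since D
    (e^p) = 0; hence the detour through J. Turning the condition D x in P into constancy modulo J
    costs denominators, and these are taken to be p-th powers because those are constants of every
    D.

    The derivations cannot single out the scalars of S, since they also kill p-th powers.
    Translations can, which is why they enter the proof of algebraic independence.

    Elements of the ultraproduct have bounded degree in order to have finitely many components; so
    every existence statement transferred to it needs degree bounds independent of s. Only primes p
    at most d matter, so finitely many bounds are added at the end. *)

Section MPoly.
Variable K : comNzRingType.

Lemma mconst_zmod n : zmod_morphism (@mconst K n).
Proof. by elim: n => [|n IH] x y //=; rewrite IH rmorphB. Qed.

Lemma mconst_monoid n : monoid_morphism (@mconst K n).
Proof.
split; first by elim: n => //= n ->.
by elim: n => [|n IH] x y //=; rewrite IH rmorphM.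
Qed.

HB.instance Definition _ n :=
  GRing.isZmodMorphism.Build K (mpoly K n) (@mconst K n) (@mconst_zmod n).
HB.instance Definition _ n :=
  GRing.isMonoidMorphism.Build K (mpoly K n) (@mconst K n) (@mconst_monoid n).

(* Junk value 0 when [n <= i]. *)
Fixpoint mX (n i : nat) : mpoly K n :=
  match n return mpoly K n with
  | 0 => 0
  | n'.+1 => if i == n' then 'X else ((mX n' i)%:P : {poly mpoly K n'})
  end.

Lemma mpoly_ind n (Q : mpoly K n -> Prop) :
  (forall c, Q (mconst n c)) -> (forall i, (i < n)%N -> Q (mX n i)) ->
  (forall f g, Q f -> Q g -> Q (f + g)) -> (forall f g, Q f -> Q g -> Q (f * g)) ->
  forall f, Q f.
Proof.
elim: n Q => [|n IH] Q Qc Qx QD QM //= f.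
have QP (c : mpoly K n) : Q (c%:P : {poly mpoly K n}).
  apply: (IH (fun c => Q (c%:P : {poly mpoly K n}))) => {c} [c|i lin|f' g|f' g].
  - exact: Qc.
  - by have := Qx i (ltnW lin); rewrite /= ltn_eqF.
  - by rewrite polyCD; apply: QD.
  - by rewrite polyCM; apply: QM.
elim/poly_ind: f => [|p c Qp]; first exact: QP 0.
apply: QD (QP c); apply: QM => //.
by have := Qx n (ltnSn n); rewrite /= eqxx.
Qed.

Section Eval.
Variables (T : comNzRingType) (phi : {rmorphism K -> T}) (x : nat -> T).

Fixpoint mev n : {rmorphism mpoly K n -> T} :=
  match n return {rmorphism mpoly K n -> T} with
  | 0 => phi
  | n'.+1 => GRing.RMorphism.clone _ _
      (horner_morph (fun a => mulrC (x n') (mev n' a))) _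
  end.

Lemma mev_const n c : mev n (mconst n c) = phi c.
Proof. by elim: n => //= n IH; rewrite horner_morphC. Qed.

Lemma mev_X n i : (i < n)%N -> mev n (mX n i) = x i.
Proof.
elim: n => //= n IH; rewrite ltnS; case: eqP => [->|/eqP ne] lin.
  by rewrite horner_morphX.
by rewrite horner_morphC IH // ltn_neqAle ne.
Qed.

Lemma mev_uniq n (psi : {rmorphism mpoly K n -> T}) :
  (forall c, psi (mconst n c) = phi c) -> (forall i, (i < n)%N -> psi (mX n i) = x i) ->
  psi =1 mev n.
Proof.
move=> hc hx f; elim/mpoly_ind: f => [c|i lin|f g Hf Hg|f g Hf Hg].
- by rewrite hc mev_const.
- by rewrite hx // mev_X.
- by rewrite !rmorphD Hf Hg.
- by rewrite !rmorphM Hf Hg.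
Qed.
End Eval.

Lemma eq_mev (T : comNzRingType) (phi : {rmorphism K -> T}) (x y : nat -> T) n f :
  (forall i, (i < n)%N -> x i = y i) -> mev phi x n f = mev phi y n f.
Proof. by move=> h; apply: mev_uniq => [c|i lin]; rewrite ?mev_const ?mev_X ?h. Qed.

Lemma mev_id n f : mev (mconst n) (mX n) n f = f.
Proof. by apply/esym; apply: (mev_uniq (psi := idfun)). Qed.

Lemma mev_comp (T U : comNzRingType) (phi : {rmorphism K -> T})
    (psi : {rmorphism T -> U}) (phi' : {rmorphism K -> U}) (x : nat -> T) n f :
  (forall c, psi (phi c) = phi' c) ->
  psi (mev phi x n f) = mev phi' (psi \o x) n f.
Proof.
move=> h; apply: (mev_uniq (psi := psi \o mev phi x n)) => [c|i lin] /=.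
  by rewrite mev_const.
by rewrite mev_X.
Qed.

(** * Leibniz rule and chain rule *)

Lemma pderivD n i (f g : mpoly K n) : pderiv i (f + g) = pderiv i f + pderiv i g.
Proof.
elim: n f g => [|n IH] f g /=; first by rewrite addr0.
have z : pderiv i (0 : mpoly K n) = 0.
  by apply: (addrI (pderiv i 0)); rewrite -IH !addr0.
case: eqP => _; first exact: derivD.
by apply/polyP=> j; rewrite coefD !coef_map_id0 // coefD IH.
Qed.

Lemma pderiv0 n i : pderiv i (0 : mpoly K n) = 0.
Proof. by apply: (addrI (pderiv i (0 : mpoly K n))); rewrite -pderivD !addr0. Qed.

Lemma pderiv_sum n i (I : Type) (r : seq I) (P : pred I) (F : I -> mpoly K n) :
  pderiv i (\sum_(j <- r | P j) F j) = \sum_(j <- r | P j) pderiv i (F j).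
Proof. exact: (big_morph _ (@pderivD n i) (pderiv0 n i)). Qed.

Lemma pderivN n i (f : mpoly K n) : pderiv i (- f) = - pderiv i f.
Proof. by apply: (addrI (pderiv i f)); rewrite -pderivD !subrr pderiv0. Qed.

Lemma pderivB n i (f g : mpoly K n) : pderiv i (f - g) = pderiv i f - pderiv i g.
Proof. by rewrite pderivD pderivN. Qed.

Lemma pderivM n i (f g : mpoly K n) :
  pderiv i (f * g) = pderiv i f * g + f * pderiv i g.
Proof.
elim: n f g => [|n IH] f g /=; first by rewrite mul0r mulr0 addr0.
case: eqP => _; first exact: derivM.
apply/polyP=> j; rewrite coefD !coef_map_id0 ?pderiv0 // !coefM pderiv_sum -big_split.
by apply: eq_bigr => l _ /=; rewrite IH !coef_map_id0 ?pderiv0.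
Qed.

Lemma pderiv_const n i (c : K) : pderiv i (mconst n c) = 0.
Proof.
elim: n => //= n IH; case: eqP => _; first by rewrite derivC.
apply/polyP=> j; rewrite coef_map_id0 ?pderiv0 // coefC coef0.
by case: eqP => _; rewrite ?pderiv0.
Qed.

Lemma pderiv_X n i j : (j < n)%N -> pderiv i (mX n j) = (i == j)%:R.
Proof.
elim: n => //= n IH; rewrite ltnS leq_eqVlt => /predU1P[->|ljn].
  rewrite eqxx; case: eqP => _; first by rewrite derivX.
  apply/polyP=> l; rewrite coef_map_id0 ?pderiv0 // coefX coef0.
  by case: eqP => _; rewrite ?pderiv0 // -(rmorph1 (mconst n)) pderiv_const.
rewrite (ltn_eqF ljn); case: eqP => [->|_].
  by rewrite derivC (gtn_eqF ljn).
apply/polyP=> l; rewrite coef_map_id0 ?pderiv0 // coefC.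
case: eqP => [->|/eqP nl].
  by rewrite IH //; case: (i == j); rewrite ?coef1 ?coef0.
by rewrite pderiv0; case: (i == j); rewrite ?coef1 ?coef0 // (negPf nl).
Qed.

Lemma pderiv_ge n i (f : mpoly K n) : (n <= i)%N -> pderiv i f = 0.
Proof.
elim: n f => //= n IH f lni; rewrite gtn_eqF //.
by apply/polyP=> j; rewrite coef_map_id0 ?pderiv0 // IH ?coef0 // ltnW.
Qed.

Lemma pderiv_natX n i (f : mpoly K n) k :
  pderiv i (f ^+ k) = f ^+ k.-1 * pderiv i f *+ k.
Proof.
elim: k => [|k IH]; first by rewrite expr0 -(rmorph1 (mconst n)) pderiv_const mulr0n.
rewrite exprS pderivM IH; case: k {IH} => [|k]; first by rewrite /= expr0 mulr1 mul1r mulr0n mulr0 addr0.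
by rewrite /= mulrnAr mulrA -exprS mulrC -mulrS.
Qed.

Lemma pderivC n i j (f : mpoly K n) : pderiv i (pderiv j f) = pderiv j (pderiv i f).
Proof.
elim/mpoly_ind: f => [c|l lin|f g Hf Hg|f g Hf Hg].
- by rewrite !pderiv_const !pderiv0.
- rewrite !pderiv_X // -!(rmorph_nat (mconst n)) !pderiv_const //.
- by rewrite !pderivD Hf Hg.
- by rewrite !pderivM !pderivD !pderivM Hf Hg; ring.
Qed.

(** Here [d] is a bare function with the laws of a derivation, so that the rule serves for partial
    derivatives, for their action on coefficients, and for the derivative in the grading
    variable. *)
Lemma chain_rule (T : comNzRingType) (phi : {rmorphism K -> T}) (x : nat -> T)
    (d : T -> T) n f :
  (forall a b, d (a + b) = d a + d b) -> (forall a b, d (a * b) = d a * b + a * d b) ->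
  (forall c, d (phi c) = 0) ->
  d (mev phi x n f) = \sum_(i < n) mev phi x n (pderiv i f) * d (x i).
Proof.
move=> dD dM dc; elim/mpoly_ind: f => [c|i lin|f g Hf Hg|f g Hf Hg].
- by rewrite mev_const dc big1 // => i _; rewrite pderiv_const rmorph0 mul0r.
- rewrite mev_X // (bigD1 (Ordinal lin)) //= pderiv_X // eqxx rmorph1 mul1r big1 ?addr0 //.
  by move=> j ne; rewrite pderiv_X // -val_eqE /= in ne *; rewrite (negPf ne) rmorph0 mul0r.
- rewrite rmorphD dD Hf Hg -big_split; apply: eq_bigr => i _ /=.
  by rewrite pderivD rmorphD mulrDl.
- rewrite rmorphM dM Hf Hg mulr_suml mulr_sumr -big_split; apply: eq_bigr => i _ /=.
  by rewrite pderivM rmorphD !rmorphM; ring.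
Qed.

Definition wid n m : {rmorphism mpoly K n -> mpoly K m} := mev (mconst m) (mX m) n.

Lemma wid_inj n m : (n <= m)%N -> injective (wid n m).
Proof.
move=> lenm; apply: (can_inj (g := mev (mconst n) (mX n) m)) => f.
rewrite /wid (mev_comp (phi' := mconst n)) => [|c]; last by rewrite mev_const.
rewrite -[RHS](mev_id f); apply: eq_mev => i lin /=.
by rewrite mev_X //; apply: leq_trans lenm.
Qed.

Lemma mev_wid (T : comNzRingType) (phi : {rmorphism K -> T}) (x y : nat -> T) n m f :
  (n <= m)%N -> (forall i, (i < n)%N -> y i = x i) ->
  mev phi y m (wid n m f) = mev phi x n f.
Proof.
move=> lenm h; rewrite (mev_comp (phi' := phi)) => [|c]; last by rewrite mev_const.
by apply: eq_mev => i lin /=; rewrite mev_X ?h //; apply: leq_trans lenm.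
Qed.

Lemma pderiv_wid n m j (f : mpoly K n) : (n <= m)%N -> (j < n)%N ->
  pderiv j (wid n m f) = wid n m (pderiv j f).
Proof.
move=> lenm ljn.
rewrite (@chain_rule _ (mconst m) (mX m) (@pderiv K m j)); first last.
- exact: pderiv_const.
- exact: pderivM.
- exact: pderivD.
rewrite (bigD1 (Ordinal ljn)) //= pderiv_X ?eqxx ?mulr1 ?(leq_trans ljn) // big1 ?addr0 //.
move=> i; rewrite -val_eqE /= => ne.
by rewrite pderiv_X ?(leq_trans (ltn_ord i)) // eq_sym (negPf ne) mulr0.
Qed.

End MPoly.

(* Any statement about domains applies to [mpoly K n] by rewriting with this equation. *)
Lemma mpoly_idomain (K : idomainType) n :
  exists R : idomainType, (R : comNzRingType) = mpoly K n.
Proof.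
elim: n => [|n [R E]]; first by exists K.
by exists {poly R}; rewrite /= -E.
Qed.

Lemma mpoly_mulf_eq0 (K : idomainType) n (f g : mpoly K n) : f * g = 0 -> f = 0 \/ g = 0.
Proof.
have [R E] := mpoly_idomain K n; move: f g; rewrite -E => f g /eqP.
by rewrite mulf_eq0 => /orP[] /eqP; [left | right].
Qed.

Lemma mpoly_size_exp (K : idomainType) n (q : {poly mpoly K n}) k :
  (0 < k)%N -> ((size q).-1 * k < size (q ^+ k))%N || (q == 0).
Proof.
have [R E] := mpoly_idomain K n; move: q; rewrite -E => q k_gt0.
have [->|nz] := eqVneq q 0; first by rewrite orbT.
by rewrite orbF -size_exp prednK // size_poly_gt0 expf_neq0.
Qed.

(** * Ideals and gradings *)

Section Ideals.
Variable T : comNzRingType.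

(** Only the first [r] terms of the sequence count; families are thus lengthened without casts
    between ordinal types. *)
Definition idl (r : nat) (t : nat -> T) (x : T) : Prop :=
  exists a : nat -> T, x = \sum_(j < r) a j * t j.

Lemma idl0 r t : idl r t 0.
Proof. by exists (fun=> 0); rewrite big1 // => j _; rewrite mul0r. Qed.

Lemma idlD r t x y : idl r t x -> idl r t y -> idl r t (x + y).
Proof.
move=> [a ->] [b ->]; exists (fun j => a j + b j); rewrite -big_split.
by apply: eq_bigr => j _ /=; rewrite mulrDl.
Qed.

Lemma idlMl r t x y : idl r t y -> idl r t (x * y).
Proof.
move=> [a ->]; exists (fun j => x * a j); rewrite mulr_sumr.
by apply: eq_bigr => j _; rewrite mulrA.
Qed.

Lemma idlMr r t x y : idl r t x -> idl r t (x * y).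
Proof. by rewrite mulrC; apply: idlMl. Qed.

Lemma idlN r t x : idl r t x -> idl r t (- x).
Proof. by rewrite -mulN1r; apply: idlMl. Qed.

Lemma idlB r t x y : idl r t x -> idl r t y -> idl r t (x - y).
Proof. by move=> hx hy; apply: idlD hx (idlN hy). Qed.

Lemma idl_sum r t (I : Type) (s : seq I) (P : pred I) (F : I -> T) :
  (forall i, P i -> idl r t (F i)) -> idl r t (\sum_(i <- s | P i) F i).
Proof. by move=> h; apply: big_ind => //; [exact: idl0 | exact: idlD]. Qed.

Lemma idl_gen r t j : (j < r)%N -> idl r t (t j).
Proof.
move=> ljr; exists (fun i => (i == j)%:R); rewrite (bigD1 (Ordinal ljr)) //= eqxx mul1r.
by rewrite big1 ?addr0 // => i; rewrite -val_eqE /= => /negPf->; rewrite mul0r.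
Qed.

Lemma idl_sub r t r' t' x : (forall j, (j < r)%N -> idl r' t' (t j)) ->
  idl r t x -> idl r' t' x.
Proof. by move=> h [a ->]; apply: idl_sum => j _; apply/idlMl/h. Qed.

End Ideals.

(** * Gradings and leading forms *)

Section Grading.
Variables (T : comNzRingType) (sg : {rmorphism T -> {poly T}}).

(* [sg x] stands for the sum of the [x_k * t ^ k], where [x_k] is the component of [x] of
   degree [k]. *)
Definition hom k x := sg x = x%:P * 'X^k.

Definition grading := (forall x, (sg x).[1] = x) /\ (forall x k, hom k (sg x)`_k).

Lemma coef_hom k x l : hom k x -> (sg x)`_l = x *+ (l == k).
Proof. by move=> ->; rewrite coefCM coefXn mulr_natr. Qed.

Lemma homP k x : (forall l, (sg x)`_l = x *+ (l == k)) -> hom k x.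
Proof. by move=> h; apply/polyP=> l; rewrite h coefCM coefXn mulr_natr. Qed.

Lemma hom0 k : hom k 0.
Proof. by rewrite /hom rmorph0 polyC0 mul0r. Qed.

Lemma homD k x y : hom k x -> hom k y -> hom k (x + y).
Proof. by rewrite /hom => hx hy; rewrite rmorphD hx hy polyCD mulrDl. Qed.

Lemma homM k l x y : hom k x -> hom l y -> hom (k + l) (x * y).
Proof. by rewrite /hom => hx hy; rewrite rmorphM hx hy polyCM exprD; ring. Qed.

Lemma hom1 : hom 0 1.
Proof. by rewrite /hom rmorph1 mulr1. Qed.

Lemma homX k x m : hom k x -> hom (k * m) (x ^+ m).
Proof.
move=> hx; elim: m => [|m IH]; first by rewrite muln0 expr0; exact: hom1.
by rewrite mulnS exprS; apply: homM.
Qed.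

Lemma hom_sum k (I : Type) (s : seq I) (P : pred I) (F : I -> T) :
  (forall i, P i -> hom k (F i)) -> hom k (\sum_(i <- s | P i) F i).
Proof. by move=> h; apply: big_ind => //; [exact: hom0 | exact: homD]. Qed.

Lemma hom_size k x : hom k x -> (size (sg x) <= k.+1)%N.
Proof.
move=> hx; apply/leq_sizeP => j ljk; rewrite (coef_hom _ hx) gtn_eqF ?mulr0n //.
Qed.

Lemma hom_uniq k l x : hom k x -> hom l x -> k != l -> x = 0.
Proof.
move=> hk hl ne; have := coef_hom k hk.
by rewrite (coef_hom k hl) eqxx (negPf ne) mulr0n mulr1n => ->.
Qed.

Lemma coef_sgM a t u m : hom u t ->
  (sg (a * t))`_m = if (u <= m)%N then (sg a)`_(m - u) * t else 0.
Proof. by move=> ht; rewrite rmorphM ht mulrA coefMXn ltnNge coefMC; case: leqP. Qed.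

Hypothesis gr : grading.

Lemma sum_hc x M : (size (sg x) <= M)%N -> x = \sum_(k < M) (sg x)`_k.
Proof.
move=> hM; rewrite -{1}[x]gr.1 (horner_coef_wide _ hM).
by apply: eq_bigr => k _; rewrite expr1n mulr1.
Qed.

(** Each coefficient is replaced by its component of complementary degree. Generators of degree
    above [m] get the coefficient 0, so they can be discarded later. *)
Lemma idl_hom r t (u : nat -> nat) x m : (forall j, (j < r)%N -> hom (u j) (t j)) ->
  hom m x -> idl r t x ->
  exists a : nat -> T, [/\ forall j, (u j <= m)%N -> hom (m - u j) (a j),
     forall j, (m < u j)%N -> a j = 0 & x = \sum_(j < r) a j * t j].
Proof.
move=> ht hx [a xE].
exists (fun j => if (u j <= m)%N then (sg (a j))`_(m - u j) else 0); split.
- by move=> j ->; apply: gr.2.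
- by move=> j; rewrite ltnNge; case: leqP.
have := coef_hom m hx; rewrite eqxx mulr1n => <-.
rewrite {1}xE rmorph_sum coef_sum; apply: eq_bigr => j _.
by rewrite (coef_sgM _ _ (ht _ _)) //; case: leqP => //; rewrite mul0r.
Qed.

(** The leading form in degree [k], which is allowed to be 0. *)
Definition top k x y := (size (sg x) <= k.+1)%N /\ (sg x)`_k = y.

Lemma topD k x y x' y' : top k x y -> top k x' y' -> top k (x + x') (y + y').
Proof.
move=> [s1 e1] [s2 e2]; split; last by rewrite rmorphD coefD e1 e2.
by rewrite rmorphD (leq_trans (size_polyD _ _)) // geq_max s1.
Qed.

Lemma topM k l x y x' y' : top k x y -> top l x' y' -> top (k + l) (x * x') (y * y').
Proof.
move=> [s1 e1] [s2 e2]; split.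
  rewrite rmorphM (leq_trans (size_polyMleq _ _)) //.
  have := leq_add s1 s2; rewrite addSn addnS -addnS.
  by case: (_ + _)%N => [|n] //; rewrite addnS ltnS.
have lk : (k < (k + l).+1)%N by rewrite ltnS leq_addr.
rewrite rmorphM coefM (bigD1 (Ordinal lk)) //= e1 addKn e2 big1 ?addr0 //.
move=> [i li]; rewrite -val_eqE /= neq_ltn => /orP[] ik.
  rewrite [X in _ * X]nth_default ?mulr0 // (leq_trans s2) //.
  by rewrite -(ltn_add2r i) subnK // addnC ltn_add2r.
by rewrite nth_default ?mul0r // (leq_trans s1).
Qed.

Lemma top0 k : top k 0 0.
Proof. by split; rewrite rmorph0 ?size_poly0 ?coef0. Qed.

Lemma top_hom k x : hom k x -> top k x x.
Proof. by move=> hx; split; [apply: hom_size | rewrite (coef_hom _ hx) eqxx]. Qed.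

Lemma top_sum k (I : Type) (s : seq I) (P : pred I) (F G : I -> T) :
  (forall i, P i -> top k (F i) (G i)) ->
  top k (\sum_(i <- s | P i) F i) (\sum_(i <- s | P i) G i).
Proof. by move=> h; apply: big_ind2 => //; [exact: top0 | move=> *; exact: topD]. Qed.

Lemma size_top_sub k x y : top k x y -> hom k y -> (size (sg (x - y)%R) <= k)%N.
Proof.
move=> [s1 e1] hy; apply/leq_sizeP => j; rewrite rmorphB coefB (coef_hom _ hy).
rewrite leq_eqVlt => /predU1P[<-|lkj]; first by rewrite e1 eqxx subrr.
by rewrite nth_default ?(leq_trans s1) // gtn_eqF // mulr0n subrr.
Qed.

End Grading.

(** * Weighted gradings of polynomial rings *)

Section MGrading.
Variables (K : comNzRingType) (w : nat -> nat) (n : nat).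

Definition msg : {rmorphism mpoly K n -> {poly mpoly K n}} :=
  mev (polyC \o mconst n) (fun i => (mX K n i)%:P * 'X^(w i)) n.

Lemma msg_const c : msg (mconst n c) = (mconst n c)%:P.
Proof. exact: mev_const. Qed.

Lemma msg_X i : (i < n)%N -> msg (mX K n i) = (mX K n i)%:P * 'X^(w i).
Proof. exact: mev_X. Qed.

Lemma hom_const c : hom msg 0 (mconst n c).
Proof. by rewrite /hom msg_const mulr1. Qed.

Lemma hom_X i : (i < n)%N -> hom msg (w i) (mX K n i).
Proof. exact: msg_X. Qed.

Lemma msg_grading : grading msg.
Proof.
split=> f; elim/mpoly_ind: f => [c|i lin|f g Hf Hg|f g Hf Hg].
- by rewrite msg_const hornerC.
- by rewrite msg_X // hornerM hornerC hornerXn expr1n mulr1.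
- by rewrite rmorphD hornerD Hf Hg.
- by rewrite rmorphM hornerM Hf Hg.
- move=> k; rewrite (coef_hom _ (hom_const c)); case: eqP => [->|_]; first exact: hom_const.
  exact: hom0.
- move=> k; rewrite (coef_hom _ (hom_X lin)); case: eqP => [->|_]; first exact: hom_X.
  exact: hom0.
- by move=> k; rewrite rmorphD coefD; apply: homD.
- move=> k; rewrite rmorphM coefM; apply: hom_sum => i _.
  by rewrite -{1}(subnKC (leq_ord i)); apply: homM.
Qed.

Lemma coef0_msg f : (forall i, (i < n)%N -> (0 < w i)%N) ->
  (msg f)`_0 = mconst n (mev idfun (fun=> 0) n f).
Proof.
move=> w_gt0; elim/mpoly_ind: f => [c|i lin|f g Hf Hg|f g Hf Hg].
- by rewrite msg_const mev_const coefC.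
- by rewrite msg_X // mev_X // rmorph0 coefCM coefXn eq_sym gtn_eqF ?mulr0 ?w_gt0.
- by rewrite !rmorphD coefD Hf Hg.
- by rewrite !rmorphM coefM big_ord1 /= subnn Hf Hg.
Qed.

Lemma mev_msg (T : comNzRingType) (sg : {rmorphism T -> {poly T}})
    (phi : {rmorphism K -> T}) (x : nat -> T) f :
  (forall c, hom sg 0 (phi c)) -> (forall i, (i < n)%N -> hom sg (w i) (x i)) ->
  sg (mev phi x n f) = map_poly (mev phi x n) (msg f).
Proof.
move=> hc hx; elim/mpoly_ind: f => [c|i lin|f g Hf Hg|f g Hf Hg].
- by rewrite msg_const map_polyC /= mev_const hc mulr1.
- by rewrite msg_X // mev_X // hx // rmorphM /= map_polyC map_polyXn /= mev_X.
- by rewrite !rmorphD Hf Hg.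
- by rewrite !rmorphM Hf Hg.
Qed.

Lemma mev_hom (T : comNzRingType) (sg : {rmorphism T -> {poly T}})
    (phi : {rmorphism K -> T}) (x : nat -> T) k f :
  (forall c, hom sg 0 (phi c)) -> (forall i, (i < n)%N -> hom sg (w i) (x i)) ->
  hom msg k f -> hom sg k (mev phi x n f).
Proof.
move=> hc hx hf; rewrite /hom (mev_msg _ hc hx) hf rmorphM /=.
by rewrite map_polyC map_polyXn.
Qed.

Lemma pderiv_msg j f : (j < n)%N ->
  map_poly (@pderiv K n j) (msg f) = msg (pderiv j f) * 'X^(w j).
Proof.
move=> ljn; have dE (q : mpoly K n.+1) : pderiv j q = map_poly (@pderiv K n j) q.
  by rewrite /= ltn_eqF.
have dC (c : mpoly K n) : map_poly (@pderiv K n j) c%:P = (pderiv j c)%:P.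
  by apply/polyP=> l; rewrite coef_map_id0 ?pderiv0 // !coefC; case: eqP; rewrite ?pderiv0.
have dX m : map_poly (@pderiv K n j) 'X^m = 0.
  apply/polyP=> l; rewrite coef_map_id0 ?pderiv0 // coefXn coef0.
  by case: eqP; rewrite ?pderiv0 // -(rmorph1 (mconst n)) pderiv_const.
rewrite (@chain_rule _ _ _ _ (map_poly (@pderiv K n j))); first last.
- by move=> c; rewrite /= dC pderiv_const.
- by move=> a b; rewrite -!dE pderivM.
- by move=> a b; rewrite -!dE pderivD.
rewrite (bigD1 (Ordinal ljn)) //= big1 ?addr0.
  have := @pderivM K n.+1 j ((mX K n j)%:P : {poly _}) 'X^(w j).
  by rewrite !dE dC dX mulr0 addr0 => ->; rewrite pderiv_X // eqxx mul1r.
move=> i; rewrite -val_eqE /= => ne.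
have := @pderivM K n.+1 j ((mX K n i)%:P : {poly _}) 'X^(w i).
by rewrite !dE dC dX mulr0 addr0 => ->; rewrite pderiv_X // eq_sym (negPf ne) mul0r mulr0.
Qed.

(** A polynomial of weighted degree below the weight of X_j cannot involve X_j. *)
Lemma size_pderiv_msg j f m : (j < n)%N -> (size (msg f) <= m)%N -> (m <= w j)%N ->
  pderiv j f = 0.
Proof.
move=> ljn sf mw.
rewrite -(msg_grading.1 (pderiv j f)) [msg _](_ : _ = 0) ?horner0 //.
apply/polyP=> l; rewrite coef0.
have -> : (msg (pderiv j f))`_l = (msg (pderiv j f) * 'X^(w j))`_(l + w j).
  by rewrite coefMXn ltnNge leq_addl /= addnK.
by rewrite -pderiv_msg // coef_map_id0 ?pderiv0 // nth_default ?pderiv0 //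
  (leq_trans sf) // (leq_trans mw) // leq_addl.
Qed.

Lemma hom_pderiv j f k : (j < n)%N -> hom msg (k + w j) f -> hom msg k (pderiv j f).
Proof.
move=> ljn hf; apply: homP => l.
have -> : (msg (pderiv j f))`_l = (msg (pderiv j f) * 'X^(w j))`_(l + w j).
  by rewrite coefMXn ltnNge leq_addl /= addnK.
rewrite -pderiv_msg // coef_map_id0 ?pderiv0 // (coef_hom _ hf) eqn_add2r.
by case: eqP => _; rewrite ?mulr1n ?mulr0n ?pderiv0.
Qed.

Lemma mev_top (T : comNzRingType) (sg : {rmorphism T -> {poly T}})
    (phi : {rmorphism K -> T}) (x y : nat -> T) k f :
  (forall c, hom sg 0 (phi c)) -> (forall i, (i < n)%N -> top sg (w i) (x i) (y i)) ->
  hom msg k f -> top sg k (mev phi x n f) (mev phi y n f).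
Proof.
move=> hc hxy hf.
(* Induction over polynomials leaves the homogeneous ones, so all components are treated at once. *)
suff /(_ k): forall l, top sg l (mev phi x n (msg f)`_l) (mev phi y n (msg f)`_l).
  by rewrite (coef_hom _ hf) eqxx mulr1n.
elim/mpoly_ind: {k hf} f => [c|i lin|f g Hf Hg|f g Hf Hg] l.
- rewrite (coef_hom _ (hom_const c)); case: eqP => [->|_]; last by rewrite !rmorph0; exact: top0.
  by rewrite mulr1n !mev_const; apply: top_hom.
- rewrite (coef_hom _ (hom_X lin)); case: eqP => [->|_]; last by rewrite !rmorph0; exact: top0.
  by rewrite mulr1n !mev_X //; apply: hxy.
- by rewrite rmorphD coefD !rmorphD; apply: topD.
- rewrite rmorphM coefM !rmorph_sum; apply: top_sum => i _; rewrite !rmorphM.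
  by rewrite -{1}(subnKC (leq_ord i)); apply: topM.
Qed.

End MGrading.

Lemma homogP (K : comNzRingType) n d (f : mpoly K n) :
  homog d f <-> hom (msg K (fun=> 1%N) n) d f.
Proof.
elim: n d f => [|n IH] d f.
  have fE : msg K (fun=> 1%N) 0 f = (f : K)%:P by apply: (@msg_const K (fun=> 1%N) 0).
  split=> [[->|->]|]; first by rewrite /hom fE mulr1.
    exact: hom0.
  case: d => [|d]; first by left.
  by rewrite /hom fE => /polyP/(_ 0%N); rewrite coefC coefMXn /= => ->; right.
have cE (g : mpoly K n.+1) k j : ((msg K (fun=> 1%N) n.+1 g)`_k : {poly mpoly K n})`_j =
    if (j <= k)%N then (msg K (fun=> 1%N) n (g : {poly mpoly K n})`_j)`_(k - j) else 0.
  elim/poly_ind: (g : {poly _}) k j => [|p c IHp] k j.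
    by rewrite rmorph0 !coef0 rmorph0 coef0; case: ifP.
  have Xc : msg K (fun=> 1%N) n.+1 ('X : {poly mpoly K n}) = ('X : {poly mpoly K n})%:P * 'X^1.
    have Xn : mX K n.+1 n = 'X :> {poly mpoly K n} by rewrite /= eqxx.
    by rewrite -Xn (@msg_X K (fun=> 1%N) n.+1 n (ltnSn n)).
  have Cc : msg K (fun=> 1%N) n.+1 (c%:P : {poly mpoly K n}) =
            map_poly polyC (msg K (fun=> 1%N) n c).
    elim/mpoly_ind: {IHp} c => [c|i lin|a b Ha Hb|a b Ha Hb].
    - by rewrite msg_const map_polyC /=; apply: (@msg_const K _ n.+1).
    - have Xi : mX K n.+1 i = (mX K n i)%:P :> {poly mpoly K n} by rewrite /= ltn_eqF.
      rewrite -Xi (@msg_X K (fun=> 1%N) n.+1 i (ltnW lin)) Xi.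
      by rewrite msg_X // rmorphM /= map_polyC map_polyX.
    - by rewrite polyCD !rmorphD Ha Hb.
    - by rewrite polyCM !rmorphM Ha Hb.
  rewrite rmorphD rmorphM Xc Cc mulrA coefD coefMXn coef_map /=.
  rewrite coefMC coefD coefC; case: k => [|k] /=.
    rewrite coef0 add0r; case: j => [|j] //=.
    by rewrite coefD coefMX coefC /= add0r.
  rewrite coefMX subn1 /=; case: j => [|j] /=; first by rewrite add0r coefD coefMX coefC /= add0r.
  by rewrite addr0 IHp coefD coefMX coefC /= addr0 ltnS subSS.
split=> [h|h j].
  apply: homP => l; apply/polyP=> j; rewrite cE.
  have /= := h j; case: (leqP j d) => [jd /IH hj|jd ->].
    rewrite (coef_hom _ hj); case: leqP => jl.
      rewrite -(eqn_add2r j) !subnK //.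
      by case: eqP => _; rewrite ?mulr1n ?mulr0n ?coef0.
    have /negPf-> : l != d by rewrite ltn_eqF // (leq_trans jl).
    by rewrite coef0.
  by rewrite rmorph0 coef0 if_same; case: eqP => _; rewrite ?mulr0n ?mulr1n ?coef0 // (_ : f`_j = 0) //; have := h j; rewrite leqNgt jd.
case: leqP => jd.
  apply/IH; apply: homP => l; have := cE f (l + j)%N j.
  rewrite leq_addl addnK => <-; rewrite (coef_hom _ h) -{1}(subnK jd) eqn_add2r.
  by case: eqP => _; rewrite ?mulr1n ?mulr0n ?coef0.
have := cE f d j; rewrite (coef_hom _ h) eqxx mulr1n leqNgt jd => ->.
by [].
Qed.

(** * Polynomials in characteristic p *)

Section Truncation.
Variables (T : comNzRingType) (sg : {rmorphism T -> {poly T}}).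
Hypothesis gr : grading sg.

Definition trunc M x := \sum_(m < M) (sg x)`_m.

Lemma truncD M x y : trunc M (x + y) = trunc M x + trunc M y.
Proof. by rewrite -big_split; apply: eq_bigr => m _; rewrite rmorphD coefD. Qed.

Lemma trunc_id M x : (size (sg x) <= M)%N -> trunc M x = x.
Proof. by move=> sx; rewrite [RHS](sum_hc gr sx). Qed.

Lemma size_trunc M x : (size (sg (trunc M x)) <= M)%N.
Proof.
rewrite rmorph_sum (leq_trans (size_sum _ _ _)) //; apply/bigmax_leqP=> m _.
by rewrite (leq_trans (hom_size (gr.2 x m))).
Qed.

Lemma truncM M a t u : hom sg u t -> trunc M (a * t) = trunc (M - u) a * t.
Proof.
move=> ht; rewrite /trunc mulr_suml.
under eq_bigr do rewrite (coef_sgM _ _ ht).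
case: (leqP u M) => uM.
  move: (subnKC uM); move: (M - u)%N => m mE; subst M.
  rewrite big_split_ord /= big1 ?add0r.
    by apply: eq_bigr => l _; rewrite leq_addr addKn.
  by move=> i _; rewrite leqNgt ltn_ord.
rewrite big1 => [|i _]; last by rewrite leqNgt (ltn_trans (ltn_ord i)).
by move/ltnW: uM; rewrite -subn_eq0 => /eqP->; rewrite big_ord0.
Qed.

Lemma idl_trunc r t (u : nat -> nat) x M : (forall j, (j < r)%N -> hom sg (u j) (t j)) ->
  (size (sg x) <= M)%N -> idl r t x ->
  exists2 a : nat -> T, (forall j, (size (sg (a j)) <= M)%N) &
    x = \sum_(j < r) a j * t j.
Proof.
move=> ht sx [a xE]; exists (fun j => trunc (M - u j) (a j)) => [j|].
  by rewrite (leq_trans (size_trunc _ _)) // leq_subr.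
rewrite -{1}(trunc_id sx) {1}xE (big_morph _ (truncD M) (_ : trunc M 0 = 0)).
  by apply: eq_bigr => j _; rewrite (truncM _ _ (ht _ _)).
by rewrite /trunc big1 // => m _; rewrite rmorph0 coef0.
Qed.
End Truncation.

(** A point where the leading coefficient does not vanish leaves a nonzero polynomial in the last
    variable. *)
Lemma nonvanishing_point (K : idomainType) n (f : mpoly K n) :
  (forall q : {poly K}, q != 0 -> exists x, q.[x] != 0) ->
  f != 0 -> exists a, mev idfun a n f != 0.
Proof.
move=> infK; elim: n f => [|n IH] f nz_f /=; first by exists (fun=> 0).
have [a nz_a] : exists a, mev idfun a n (lead_coef (f : {poly mpoly K n})) != 0.
  by apply: IH; rewrite lead_coef_eq0.
have /infK[x nz_x] : map_poly (mev idfun a n) f != 0.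
  by apply/eqP=> /polyP/(_ (size (f : {poly _})).-1)/eqP; rewrite coef_map coef0 (negPf nz_a).
exists (fun i => if i == n then x else a i); rewrite /horner_morph eqxx.
suff -> : map_poly (mev idfun (fun i => if i == n then x else a i) n) f =
          map_poly (mev idfun a n) f by [].
by apply: eq_map_poly => c; apply: eq_mev => i lin; rewrite ltn_eqF.
Qed.

(** Differentiate f (t X) = t^d f (X) with respect to t and put t = 1. *)
Lemma euler (K : comNzRingType) n d (f : mpoly K n) :
  homog d f -> \sum_(i < n) mX K n i * pderiv i f = f *+ d.
Proof.
move=> /homogP hf; have := @chain_rule K {poly mpoly K n} (polyC \o mconst n)
  (fun i => (mX K n i)%:P * 'X^1) (@deriv _) n f (@derivD _) (@derivM _) (fun c => derivC _).
rewrite -/(msg K (fun=> 1%N) n) hf => /(congr1 (horner^~ 1)).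
rewrite derivM derivC mul0r add0r derivXn.
rewrite hornerM hornerC hornerMn hornerXn expr1n mulr_natr => ->.
rewrite horner_sum; apply: eq_bigr => i _.
by rewrite derivM derivC mul0r add0r derivX mulr1 hornerM hornerC (msg_grading K _ n).1 mulrC.
Qed.

(** * Frobenius, p-th roots and a Poincare lemma *)

Section CharP.
Variables (K : fieldType) (p : nat).
Hypothesis charK : p \in [pchar K].

Let p_prime : prime p := pcharf_prime charK.

Lemma mpoly_pchar n : p \in [pchar (mpoly K n)].
Proof. exact: (rmorph_pchar (mconst n)) charK. Qed.

Lemma pchar_expD (R : comNzRingType) : p \in [pchar R] ->
  forall x y : R, (x + y) ^+ p = x ^+ p + y ^+ p.
Proof. by move=> cR x y; rewrite -!(pFrobenius_autE cR) rmorphD. Qed.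

Lemma pchar_exp_sum (R : comNzRingType) : p \in [pchar R] ->
  forall (I : Type) (r : seq I) (P : pred I) (F : I -> R),
  (\sum_(i <- r | P i) F i) ^+ p = \sum_(i <- r | P i) F i ^+ p.
Proof.
by move=> cR I r P F; apply: (big_morph _ (pchar_expD cR)); rewrite expr0n gtn_eqF ?prime_gt0.
Qed.

Lemma pderiv_exp_p n i (f : mpoly K n) : pderiv i (f ^+ p) = 0.
Proof. by rewrite pderiv_natX mulrn_pchar // mpoly_pchar. Qed.

(** A p-fold derivative multiplies coefficients by products of p consecutive integers, which p!
    divides. *)
Lemma iter_pderiv_p n i (f : mpoly K n) : iter p (pderiv i) f = 0.
Proof.
elim: n f => [|n IH] f /=; first by case: p p_prime.
have [_|ne] := eqVneq i n.
  rewrite -[LHS]/(f^`(p)); apply/polyP=> j; rewrite coef_derivn coef0.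
  rewrite -bin_ffact mulnC; case: p charK p_prime => // q cK _.
  by rewrite factS -mulnA mulrnA (mulrn_pchar (rmorph_pchar (mconst n) cK)) mul0rn.
apply/polyP=> j; rewrite coef0.
suff -> : forall k, (iter k (map_poly (@pderiv K n i)) f)`_j = iter k (pderiv i) f`_j.
  exact: IH.
by elim=> //= k IHk; rewrite coef_map_id0 ?pderiv0 // IHk.
Qed.

Hypothesis perfK : forall c : K, exists b, b ^+ p = c.

(** The outermost derivative leaves only exponents divisible by p; the coefficients are p-th powers
    by induction, in the end because K is perfect. *)
Lemma pth_root n (f : mpoly K n) :
  (forall i, (i < n)%N -> pderiv i f = 0) -> exists g, g ^+ p = f.
Proof.
elim: n f => [|n IH] f df; first exact: perfK.
have cf (j : nat) : ~~ (p %| j)%N -> (f : {poly mpoly K n})`_j = 0.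
  case: j => [|j pj]; first by rewrite dvdn0.
   have := df n (ltnSn n); rewrite /= eqxx => /polyP/(_ j).
  rewrite coef_deriv coef0 -mulr_natr => /mpoly_mulf_eq0[] // /eqP.
  by rewrite -(dvdn_pcharf (mpoly_pchar n)) (negPf pj).
have cg (j : nat) : exists g, g ^+ p = (f : {poly mpoly K n})`_j.
  apply: IH => i lin; have := df i (ltnW lin); rewrite /= ltn_eqF // => /polyP/(_ j).
  by rewrite coef_map_id0 ?pderiv0 // coef0.
have [g gE] := fin_all_exists (fun j : 'I_(size (f : {poly _})) => cg (j * p)%N).
exists (\sum_j (g j)%:P * 'X^j : {poly mpoly K n}).
rewrite (pchar_exp_sum (mpoly_pchar n.+1)); apply/polyP=> m; rewrite coef_sum.
under eq_bigr do rewrite exprMn -rmorphXn /= gE -exprM coefCM coefXn mulr_natr.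
have [pm|pm] := boolP (p %| m)%N; last first.
  by rewrite cf // big1 // => j _; case: eqP => // e; rewrite e dvdn_mull in pm.
have [mp|mp] := ltnP (m %/ p) (size (f : {poly mpoly K n})).
  rewrite (bigD1 (Ordinal mp)) //= divnK // eqxx mulr1n big1 ?addr0 // => j.
  rewrite -val_eqE /= => ne; case: eqP => // e.
  by rewrite e mulnK ?eqxx ?prime_gt0 // in ne.
rewrite [RHS]nth_default ?(leq_trans mp) ?leq_div // big1 // => j _.
by case: eqP => // e; rewrite e mulnK ?prime_gt0 // leqNgt ltn_ord in mp.
Qed.

(* Taylor expansion backwards along the variable [i]: in characteristic p it is a
   projection onto the polynomials killed by the i-th partial derivative. *)
Definition taylor0 n i (f : mpoly K n) : mpoly K n :=
  \sum_(k < p) (- mX K n i) ^+ k * mconst n ((k`!)%:R^-1) * iter k (pderiv i) f.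

Lemma pderiv_taylor0 n i (f : mpoly K n) : (i < n)%N -> pderiv i (taylor0 i f) = 0.
Proof.
move=> lin.
(* The derivative of a partial sum telescopes to its last term with one more derivative. For the
   full sum this is a p-fold derivative, hence 0. *)
suff H m : (m < p)%N -> pderiv i (\sum_(k < m.+1)
    (- mX K n i) ^+ k * mconst n ((k`!)%:R^-1) * iter k (pderiv i) f) =
    (- mX K n i) ^+ m * mconst n ((m`!)%:R^-1) * iter m.+1 (pderiv i) f.
  have := H p.-1; rewrite prednK ?prime_gt0 // leqnn => -> //.
  by rewrite -/(iter p _ f) iter_pderiv_p mulr0.
elim: m => [|m IH] mp.
  by rewrite big_ord1 expr0 mul1r fact0 invr1 rmorph1 !mul1r.
rewrite big_ord_recr pderivD IH 1?ltnW //= !pderivM pderiv_const mulr0 addr0.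
rewrite pderiv_natX pderivN pderiv_X // eqxx mulrN1 /=.
have E : mconst n (m`!%:R^-1 : K) = mconst n (m.+1`!%:R^-1 : K) *+ m.+1.
  have := rmorphMn (mconst n) m.+1 (m.+1`!%:R^-1); move=> /= <-; congr mconst; rewrite factS natrM invfM -[RHS]mulr_natr mulrAC.
  rewrite mulVf ?mul1r // -(dvdn_pcharf charK) gtnNdvd //.
by rewrite E; ring.
Qed.

Lemma pderiv_taylor0_ne n i j (f : mpoly K n) : (i < n)%N -> j != i ->
  pderiv j f = 0 -> pderiv j (taylor0 i f) = 0.
Proof.
move=> lin ne df; rewrite pderiv_sum big1 // => k _.
have -> : pderiv j (iter k (pderiv i) f) = 0 -> pderiv j ((- mX K n i) ^+ k *
   mconst n ((k`!)%:R^-1) * iter k (pderiv i) f) = 0 => //.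
  move=> E; rewrite !pderivM E pderiv_const pderiv_natX pderivN pderiv_X // (negPf ne).
  by rewrite oppr0 !mulr0 mul0rn ?mul0r ?addr0 ?mul0r ?addr0.
by elim: (k : nat) => //= l IH; rewrite pderivC IH pderiv0.
Qed.

(** The derivatives are made to vanish one variable at a time by [taylor0]. Every term of
    [taylor0 i g] but the first contains an iterated derivative of [pderiv i g], so the change stays
    in J. *)
Lemma poincare n (J : mpoly K n -> Prop) (f : mpoly K n) :
  J 0 -> (forall x y, J x -> J y -> J (x + y)) -> (forall a x, J x -> J (a * x)) ->
  (forall i x, J x -> J (pderiv i x)) ->
  (forall i, J (pderiv i f)) -> exists g, J (f - g ^+ p).
Proof.
move=> J0 JD JM Jd Jf.
have JB x y : J x -> J y -> J (x - y) by move=> ? ?; apply: JD; rewrite // -mulN1r; apply: JM.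
suff /(_ n (leqnn n))[g [Jg /pth_root[h hE]]] : forall i, (i <= n)%N ->
    exists g, J (f - g) /\ forall j, (j < i)%N -> pderiv j g = 0.
  by exists h; rewrite hE.
elim=> [|i IH] lin; first by exists f; rewrite subrr.
have [g [Jg dg]] := IH (ltnW lin); exists (taylor0 i g); split; last first.
  move=> j; rewrite ltnS leq_eqVlt => /predU1P[->|lji]; first exact: pderiv_taylor0.
  by apply: pderiv_taylor0_ne; rewrite ?ltn_eqF // dg.
have Jdg : J (pderiv i g).
  by rewrite -[g](subKr f) pderivB; apply: JB => //; apply: Jd.
rewrite /taylor0; case: (p) (prime_gt0 p_prime) => // q _.
rewrite big_ord_recl /= expr0 mul1r fact0 invr1 rmorph1 mul1r opprD addrA.
apply: JB => //; apply: big_ind => // k _; apply: JM.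
by elim: (k : nat) => //= l; apply: Jd.
Qed.

(** The degree bounds depend on [M] alone, so that solutions for all s can be assembled into
    elements of the ultraproduct. *)
Lemma poincare_hom n r (e : nat -> mpoly K n) (u : nat -> nat) (f : mpoly K n) M w :
  let sg := msg K w n in
  (forall j, (j < r)%N -> hom sg (u j) (e j)) -> (size (sg f) <= M)%N ->
  (forall i, idl r (fun j => e j ^+ p) (pderiv i f)) ->
  exists g (b : nat -> mpoly K n), [/\ (size (sg g) <= M)%N,
    forall j, (size (sg (b j)) <= M)%N & f = g ^+ p + \sum_(j < r) b j * e j ^+ p].
Proof.
move=> sg he sf df; have gr : grading sg := msg_grading K w n.
have [g] : exists g, idl r (fun j => e j ^+ p) (f - g ^+ p).
  apply: poincare => //; [exact: idl0|exact: idlD|by move=> *; apply: idlMl|].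
  move=> i x [a ->]; rewrite pderiv_sum; apply: idl_sum => j _.
  by rewrite pderivM pderiv_exp_p mulr0 addr0; apply/idlMl/(idl_gen (fun j => e j ^+ p)).
have hep j : (j < r)%N -> hom sg (u j * p)%N (e j ^+ p) by move=> /he; apply: homX.
case=> a fE.
(* The components of a p-th power also have zero derivatives, so the truncation still has a p-th
   root. *)
have [h hE] : exists h, h ^+ p = trunc sg M (g ^+ p).
  apply: pth_root => i lin; rewrite /trunc pderiv_sum big1 // => m _.
  have := pderiv_msg w (g ^+ p) lin; rewrite pderiv_exp_p rmorph0 mul0r => /polyP/(_ m).
  by rewrite coef_map_id0 ?pderiv0 // coef0.
exists h, (fun j => trunc sg (M - u j * p) (a j)); split.
- have := size_trunc gr M (g ^+ p); rewrite -hE rmorphXn.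
  have /orP[lt_s|/eqP->] := mpoly_size_exp (sg h) (prime_gt0 p_prime); last by rewrite size_poly0.
  apply: leq_trans; apply: leq_trans lt_s.
  by rewrite (leq_trans (leqSpred _)) // ltnS leq_pmulr ?prime_gt0.
- by move=> j; rewrite (leq_trans (size_trunc gr _ _)) // leq_subr.
rewrite -{1}(trunc_id gr sf) -[f in LHS](subrK (g ^+ p)) fE truncD addrC hE; congr (_ + _).
rewrite (big_morph _ (truncD sg M) (_ : trunc sg M 0 = 0)).
  by apply: eq_bigr => j _; rewrite (truncM _ _ (hep _ _)).
by rewrite /trunc big1 // => m _; rewrite rmorph0 coef0.
Qed.

End CharP.

(** * Lifting to constants *)

Section Lift.
Variables (S : comNzRingType) (p : nat) (I : Type) (D : I -> S -> S).
Hypothesis charS : p \in [pchar S].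
Hypothesis DD : forall i x y, D i (x + y) = D i x + D i y.
Hypothesis DM : forall i x y, D i (x * y) = D i x * y + x * D i y.
Hypothesis DC : forall i j x, D i (D j x) = D j (D i x).
Hypothesis Dp : forall i x, iter p (D i) x = 0.

Variables P J : S -> Prop.
Hypothesis P0 : P 0.
Hypothesis PD : forall x y, P x -> P y -> P (x + y).
Hypothesis PM : forall a x, P x -> P (a * x).
Hypothesis P1 : ~ P 1.
Hypothesis P_prime : forall x y, P (x * y) -> P x \/ P y.
Hypothesis JD : forall x y, J x -> J y -> J (x + y).
Hypothesis JM : forall a x, J x -> J (a * x).
Hypothesis J_D : forall i x, J x -> J (D i x).
Hypothesis JP : forall x, J x -> P x.

Let p_prime : prime p := pcharf_prime charS.

Lemma der0 i : D i 0 = 0.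
Proof. by apply: (addrI (D i 0)); rewrite -DD !addr0. Qed.

Lemma derN i x : D i (- x) = - D i x.
Proof. by apply: (addrI (D i x)); rewrite -DD !subrr der0. Qed.

Lemma derB i x y : D i (x - y) = D i x - D i y.
Proof. by rewrite DD derN. Qed.

Lemma der_sum i (R : Type) (r : seq R) (Q : pred R) (F : R -> S) :
  D i (\sum_(j <- r | Q j) F j) = \sum_(j <- r | Q j) D i (F j).
Proof. exact: (big_morph _ (DD i) (der0 i)). Qed.

Lemma derXS i x k : D i (x ^+ k.+1) = k.+1%:R * (x ^+ k * D i x).
Proof.
elim: k => [|k IH]; first by rewrite expr1 expr0 !mul1r.
by rewrite exprS DM IH -[k.+2%:R]natr1 exprS; ring.
Qed.

Lemma der_expp i c : D i (c ^+ p) = 0.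
Proof.
by rewrite -{1}(prednK (prime_gt0 p_prime)) derXS prednK ?prime_gt0 // pcharf0 ?mul0r.
Qed.

Lemma der_exppM i c x : D i (c ^+ p * x) = c ^+ p * D i x.
Proof. by rewrite DM der_expp mul0r add0r. Qed.

Lemma nat_expp k : k%:R ^+ p = k%:R :> S.
Proof. by rewrite -(pFrobenius_autE charS) pFrobenius_aut_nat. Qed.

Lemma notP_nat k : ~~ (p %| k)%N -> ~ P k%:R.
Proof.
case: k => [|k]; first by rewrite dvdn0.
rewrite -prime_coprime // coprime_sym => /coprimeP[] // [a b] /= ab Pk; apply: P1.
have -> : (1 : S) = a%:R * k.+1%:R; last exact: PM.
have : (a * k.+1 = 1 + b * p)%N by rewrite -ab subnK // ltnW // -subn_gt0 ab.
by rewrite -natrM => ->; rewrite natrD natrM (pcharf0 charS) mulr0 addr0.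
Qed.

Lemma notPM x y : ~ P x -> ~ P y -> ~ P (x * y).
Proof. by move=> nx ny /P_prime[]. Qed.

Lemma notPX x k : ~ P x -> ~ P (x ^+ k).
Proof. by move=> nx; elim: k => [|k IH]; rewrite ?expr0 // exprS; apply: notPM. Qed.

Lemma PB x y : P x -> P y -> P (x - y).
Proof. by move=> hx hy; apply: PD => //; rewrite -mulN1r; apply: PM. Qed.

Lemma JB x y : J x -> J y -> J (x - y).
Proof. by move=> hx hy; apply: JD => //; rewrite -mulN1r; apply: JM. Qed.

Lemma J0 x : J x -> J 0.
Proof. by move=> /(JM 0); rewrite mul0r. Qed.

(** Such a B will consist of the constants of the derivations already treated. Through its p-th
    powers it contains the integers and all denominators. *)
Record dsub (B : S -> Prop) : Prop := DSub {
  dsubB : forall x y, B x -> B y -> B (x - y);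
  dsubM : forall x y, B x -> B y -> B (x * y);
  dsubX : forall x, B (x ^+ p);
  dsubD : forall i x, B x -> B (D i x) }.

Lemma dsub1 B : dsub B -> B 1.
Proof. by move=> hB; rewrite -(expr1n S p); apply: dsubX. Qed.

Lemma dsub0 B : dsub B -> B 0.
Proof. by move=> hB; rewrite -(subrr 1); apply: dsubB (dsub1 hB) (dsub1 hB). Qed.

Lemma dsubN B x : dsub B -> B x -> B (- x).
Proof. by move=> hB Bx; rewrite -sub0r; apply: dsubB (dsub0 hB) Bx. Qed.

Lemma dsub_add B x y : dsub B -> B x -> B y -> B (x + y).
Proof. by move=> hB Bx By; rewrite -(opprK y); apply: dsubB Bx (dsubN hB By). Qed.

Lemma dsub_exp B x k : dsub B -> B x -> B (x ^+ k).
Proof.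
move=> hB Bx; elim: k => [|k IH]; first exact: dsub1.
by rewrite exprS; apply: dsubM.
Qed.

(** * Elimination of one generator by one derivation *)

Section Step.
Variables (B : S -> Prop) (e : S) (i : I).
Hypotheses (hB : dsub B) (Be : B e) (Jep : J (e ^+ p)).
Let u := D i e.
Hypothesis nPu : ~ P u.

Let Bu : B u. Proof. exact: dsubD. Qed.

Let in_eBJ k x := exists2 b, B b & J (x - b * e ^+ k).

Let iter_der_exp b k m : (m <= k)%N -> B b -> exists2 b', B b' &
  iter m (D i) (b * e ^+ k) =
  (k ^_ m)%:R * (b * u ^+ m * e ^+ (k - m)) + b' * e ^+ (k - m).+1.
Proof.
move=> mk Bb; elim: m mk => [|m IH] mk.
  exists 0; first exact: dsub0.
  by rewrite subn0 expr0 mulr1 ffactn0 mul1r mul0r addr0.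
have [b' Bb' /= ->] := IH (ltnW mk).
have [l lE] : exists l, (k - m = l.+1)%N by exists (k - m).-1; rewrite prednK // subn_gt0.
have kml : (k - m.+1 = l)%N by rewrite subnS lE.
rewrite kml lE ffactnSr lE natrM.
exists ((k ^_ m)%:R * D i (b * u ^+ m) + D i b' * e + l.+2%:R * (b' * u)).
  have Bn n : B n%:R by rewrite -nat_expp; apply: dsubX.
  have Bbu : B (b * u ^+ m) by apply: dsubM => //; apply: dsub_exp.
  apply: dsub_add => //; first apply: dsub_add => //.
  - by apply: dsubM => //; apply: dsubD.
  - by apply: dsubM => //; apply: dsubD.
  - by do !apply: dsubM.
rewrite DD -(nat_expp (k ^_ m)) der_exppM !nat_expp !(DM _ _ (e ^+ _)) !derXS -/u.
move: (k ^_ m)%:R l.+1%:R l.+2%:R (D i (b * u ^+ m)) => c1 c2 c3 d.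
by rewrite !exprS; ring.
Qed.

(** Successive approximation in powers of [e]: an error b e^k is integrated, which divides by u and
    by k + 1. The error b e^(p-1) has no integral, but the vanishing of the p-th iterate of [D i]
    shows that a multiple of it lies in J. *)
Lemma lift_const : exists2 v, ~ P v & forall x, B x -> exists2 a, B a & J (D i (v ^+ p * x + a * e)).
Proof.
have H k : (k < p)%N -> exists2 v, ~ P v & forall x, B x ->
    exists2 a, B a & in_eBJ k (D i (v ^+ p * x + a * e)).
  elim: k => [|k IH] kp.
    exists 1 => // x Bx; exists 0; first exact: dsub0.
    exists (D i x); first exact: dsubD.
    by rewrite expr1n mul1r mul0r addr0 expr0 mulr1 subrr; apply: J0 Jep.
  have [v nPv vH] := IH (ltnW kp); pose c : S := k.+1%:R.
  have nPc : ~ P c by apply: notP_nat; rewrite gtnNdvd.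
  have Bc : B c by rewrite /c -nat_expp; apply: dsubX.
  exists (v * (u * c)); first by do !apply: notPM.
  move=> x Bx; have [a Ba [b Bb Jb]] := vH x Bx.
  set y := v ^+ p * x + a * e in Jb.
  (* As c^p = c, the error becomes u^p c b e^k, which is the leading term of the derivative of
     u^(p-1) b e^(k+1). *)
  exists ((u * c) ^+ p * a - u ^+ p.-1 * b * e ^+ k).
    apply: dsubB => //; first by apply: dsubM => //; apply: dsubX.
    by apply: dsubM => //; [apply: dsubM => //|]; apply: dsub_exp.
  have -> : (v * (u * c)) ^+ p * x + ((u * c) ^+ p * a - u ^+ p.-1 * b * e ^+ k) * e =
     (u * c) ^+ p * y - u ^+ p.-1 * b * e ^+ k.+1.
    by rewrite /y exprMn exprSr; ring.
  rewrite derB der_exppM (DM _ (_ * b)) derXS -/u.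
  exists (- D i (u ^+ p.-1 * b)).
    by apply: dsubN => //; apply: dsubD => //; apply: dsubM => //; apply: dsub_exp.
  have up : u ^+ p = u * u ^+ p.-1 by rewrite -exprS prednK ?prime_gt0.
  rewrite [X in J X](_ : _ = (u * c) ^+ p * (D i y - b * e ^+ k)); first exact: JM.
  rewrite exprMn /c nat_expp up -/c; move: (c) (D i (u ^+ p.-1 * b)) => c' d.
  by rewrite !exprS; ring.
have [|v nPv vH] := H p.-1; first by rewrite prednK ?prime_gt0.
pose c : S := (p.-1)`!%:R.
have nPc : ~ P c.
  apply: notP_nat; have: (p.-1 < p)%N by rewrite prednK ?prime_gt0.
  elim: (p.-1) => [|k IH] kp; first by rewrite gtnNdvd ?prime_gt1.
  by rewrite factS Euclid_dvdM // negb_or IH 1?ltnW // gtnNdvd.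
exists (v * (u * c)) => [|x Bx]; first by do !apply: notPM.
have [a Ba [b Bb Jb]] := vH x Bx.
set y := v ^+ p * x + a * e in Jb; exists ((u * c) ^+ p * a).
  by apply: dsubM => //; apply: dsubX.
have -> : (v * (u * c)) ^+ p * x + (u * c) ^+ p * a * e = (u * c) ^+ p * y.
  by rewrite /y !exprMn; ring.
rewrite der_exppM.
(* Apply [D i] to the error p - 1 more times: (p-1)! b u^(p-1) + b' e lies in J. Multiplying by u
   e^(p-1) turns the second term into a multiple of e^p. *)
have [b' Bb'] := iter_der_exp (leqnn p.-1) Bb.
rewrite subnn expr0 mulr1 expr1 ffactnn => E.
have JitD m x' : J x' -> J (iter m (D i) x') by move=> Jx; elim: m => //= m; apply: J_D.
have itB m x' y' : iter m (D i) (x' - y') = iter m (D i) x' - iter m (D i) y'.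
  by elim: m => //= m ->; rewrite derB.
have := JitD p.-1 _ Jb; rewrite itB E -iterSr prednK ?prime_gt0 // Dp sub0r -/c => Jb'.
have up : u ^+ p = u * u ^+ p.-1 by rewrite -exprS prednK ?prime_gt0.
have ep : e ^+ p = e * e ^+ p.-1 by rewrite -exprS prednK ?prime_gt0.
rewrite exprMn [c ^+ p]nat_expp -/c.
rewrite [X in J X](_ : _ = u ^+ p * c * (D i y - b * e ^+ p.-1)
   - (u * e ^+ p.-1) * - (c * (b * u ^+ p.-1) + b' * e) - (u * b') * e ^+ p).
  by apply: JB; [apply: JB|]; apply: JM.
by rewrite up ep; move: (c) => c'; ring.
Qed.

(** Let x be b e^l modulo J with 0 < l < p. As D x lies in J, l u b e^(l-1) agrees with - (D b) e^l
    modulo J. Multiplying by e raises the order of x by one, at the cost of the factor l u, until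
    e^p is reached. *)
Lemma const_torsion : exists2 t, ~ P t & forall x, B x -> J (D i x) ->
  (exists2 b, B b & J (x - b * e)) -> J (t ^+ p * x).
Proof.
suff H m : (m < p)%N -> exists2 t, ~ P t & forall x, B x -> J (D i x) ->
    in_eBJ (p - m) x -> J (t ^+ p * x).
  have [|t nPt tH] := H p.-1; first by rewrite prednK ?prime_gt0.
  exists t => // x Bx JDx [b Bb Jb]; apply: tH => //; exists b => //.
  by rewrite -subn1 subKn ?prime_gt0 // expr1.
elim: m => [|m IH] mp.
  exists 1 => // x Bx _ [b Bb]; rewrite subn0 expr1n mul1r => Jb.
  by rewrite -(subrK (b * e ^+ p) x); apply: JD => //; apply: JM.
have [t nPt tH] := IH (ltnW mp).
have [l lE] : exists l, (p - m.+1 = l.+1)%N.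
  by exists (p - m.+1).-1; rewrite prednK // subn_gt0.
have lE' : (p - m = l.+2)%N by rewrite -lE subnS prednK // subn_gt0 ltnW.
pose c : S := l.+1%:R.
have nPc : ~ P c.
  apply: notP_nat; rewrite gtnNdvd //.
  by rewrite -lE -subn_gt0 subKn // ltnW.
exists (t * (u * c)); first by do !apply: notPM.
move=> x Bx JDx; rewrite lE => -[b Bb Jb].
have -> : (t * (u * c)) ^+ p * x = t ^+ p * ((u * c) ^+ p * x) by rewrite !exprMn; ring.
apply: tH; first by apply: dsubM => //; apply: dsubX.
  by rewrite der_exppM; apply: JM.
rewrite lE'; exists (- (u ^+ p.-1 * D i b)).
  by apply: dsubN => //; apply: dsubM => //; [apply: dsub_exp | apply: dsubD].
have up : u ^+ p = u * u ^+ p.-1 by rewrite -exprS prednK ?prime_gt0.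
have := JB JDx (J_D i Jb); rewrite derB subKr DM derXS -/u -/c => Jd.
rewrite [X in J X](_ : _ = u ^+ p * c * (x - b * e ^+ l.+1) + e * u ^+ p.-1 *
  (D i b * e ^+ l.+1 + b * (c * (e ^+ l * u)))); first by apply: JD; apply: JM.
by rewrite exprMn [c ^+ p]nat_expp -/c up; move: (c) => c'; rewrite !exprS; ring.
Qed.

End Step.

(* Correcting [f] modulo [P] into a [D]-constant modulo [J]: one generator of [P] is
   eliminated at a time, replacing the ring [B] by the constants of one derivation.
   The p-th powers [w ^+ p] are constants and play the role of denominators. *)
Lemma lift_to_constants s (B : S -> Prop) (e : nat -> S) f : dsub B ->
  (forall j, (j < s)%N -> [/\ B (e j), P (e j) & J (e j ^+ p)]) ->
  (exists2 w, ~ P w & forall x, B x -> P x ->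
     exists2 b : nat -> S, (forall j, B (b j)) & J (w ^+ p * x - \sum_(j < s) b j * e j)) ->
  (forall c : nat -> S, (forall j, B (c j)) ->
     (forall i, P (\sum_(j < s) c j * D i (e j))) -> forall j, (j < s)%N -> P (c j)) ->
  B f -> (forall i, P (D i f)) ->
  exists w f0, [/\ ~ P w, P (f0 - w ^+ p * f) & forall i, J (D i f0)].
Proof.
elim: s B e f => [|s IH] B e f hB he [w nPw wH] ind Bf Pf.
  exists w, (w ^+ p * f); split=> // [|i]; first by rewrite subrr.
  rewrite der_exppM; have [b _] := wH _ (dsubD hB i Bf) (Pf i).
  by rewrite big_ord0 subr0.
(* Otherwise the coefficients 0, ..., 0, 1 form a relation modulo P, and [ind] puts 1 in P. *)
have [i nPu] : exists i, ~ P (D i (e s)).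
  apply: contrapT => /forallNP H; apply: P1.
  suff /(_ s (ltnSn s)): forall j, (j < s.+1)%N -> P (j == s)%:R by rewrite eqxx.
  apply: ind => [j|i]; first by case: eqP => _; [exact: dsub1 | exact: dsub0].
  rewrite big_ord_recr /= eqxx mul1r big1 ?add0r; first exact: contrapT.
  by move=> j _; rewrite ltn_eqF // mul0r.
have [Bes Pes Jes] := he s (ltnSn s).
have [v nPv vH] := lift_const hB Bes Jes nPu.
have [t nPt tH] := const_torsion hB Bes Jes nPu.
(* The constants of [D i] modulo J; the other derivations preserve them because they commute with
   [D i]. *)
pose B' x := B x /\ J (D i x).
have hB' : dsub B'.
  split=> [x y [Bx Jx] [By Jy]|x y [Bx Jx] [By Jy]|x|j x [Bx Jx]]; split.
  - exact: dsubB.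
  - by rewrite derB; apply: JB.
  - exact: dsubM.
  - by rewrite DM; apply: JD; [rewrite mulrC|]; apply: JM.
  - exact: dsubX.
  - by rewrite der_expp; apply: J0 Jes.
  - exact: dsubD.
  - by rewrite DC; apply: J_D.
have /boolp.choice[lf lfH] : forall x, exists a, B x -> B a /\ B' (v ^+ p * x + a * e s).
  move=> x.
  have [Bx|nBx] := pselect (B x); last by exists 0.
  have [a Ba Ja] := vH x Bx; exists a => _; split=> //; split=> //.
  by apply: dsub_add => //; apply: dsubM => //; apply: dsubX.
pose e' j := v ^+ p * e j + lf (e j) * e s.
have P'e x : P x -> P (v ^+ p * x + lf x * e s) by move=> Px; apply: PD; apply: PM.
have he' j : (j < s)%N -> [/\ B' (e' j), P (e' j) & J (e' j ^+ p)].
  move=> js; have [Bj Pj Jj] := he j (ltnW js); split; first exact: (lfH _ Bj).2.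
    exact: P'e.
  rewrite /e' (pchar_expD charS) !exprMn; apply: JD; apply: JM => //.
have [af [Ba Baf]] : exists a, B a /\ B' (v ^+ p * f + a * e s).
  by exists (lf f); apply: lfH.
(* Modulo P the derivative of the corrected f is [af * D i (e s)], and P is prime. This keeps all
   derivatives of the corrected f in P. *)
have Paf : P af.
  suff: P (af * D i (e s)) by move=> /P_prime[].
  have -> : af * D i (e s) = D i (v ^+ p * f + af * e s) - v ^+ p * D i f - D i af * e s.
    by rewrite DD der_exppM DM; ring.
  apply: PB; last exact: PM.
  by apply: PB; [apply/JP/Baf.2 | apply: PM].
have [||k|w' [f0 [nPw' Pf0 Jf0]]] := IH B' e' (v ^+ p * f + af * e s) hB' he' _ _ Baf.
(* Replacing each b_j and e_j by its lift changes the combination by a multiple of e_s only. So the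
   difference [z] is a constant divisible by e_s modulo J, and [tH] applies. *)
- exists (v * (v * (w * t))); first by do !apply: notPM.
  move=> x [Bx Jx] Px; have [b Bb Jb] := wH x Bx Px.
  exists (fun j => t ^+ p * (v ^+ p * b j + lf (b j) * e s)).
    by move=> j; apply: (dsubM hB'); [apply: (dsubX hB') | apply: (lfH _ (Bb j)).2].
  pose z := (v * (v * w)) ^+ p * x - \sum_(j < s) (v ^+ p * b j + lf (b j) * e s) * e' j.
  have -> : (v * (v * (w * t))) ^+ p * x -
     \sum_(j < s) t ^+ p * (v ^+ p * b j + lf (b j) * e s) * e' j = t ^+ p * z.
    rewrite /z mulrBr mulr_sumr; congr (_ - _); first by rewrite !exprMn; ring.
    by apply: eq_bigr => j _; rewrite mulrA.
  have B'z : B' z.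
    apply: (dsubB hB'); first by apply: (dsubM hB') => //; apply: (dsubX hB').
    apply: big_ind; [exact: (dsub0 hB')|by move=> *; apply: (dsub_add hB')|move=> j _].
    by apply: (dsubM hB'); [apply: (lfH _ (Bb j)).2 | have [] := he' j (ltn_ord j)].
  apply: tH; [exact: B'z.1|exact: B'z.2|].
  exists (v ^+ p * (v ^+ p * b s) - \sum_(j < s)
     (v ^+ p * b j * lf (e j) + lf (b j) * (v ^+ p * e j + lf (e j) * e s))).
    have Bvp : B (v ^+ p) := dsubX hB v.
    have Bef j : (j < s)%N -> B (lf (e j)) by move=> js; have [/lfH[]] := he j (ltnW js).
    have Blb j : B (lf (b j)) := (lfH _ (Bb j)).1.
    apply: (dsubB hB); first by do !apply: (dsubM hB).
    apply: big_ind; [exact: (dsub0 hB)|by move=> *; apply: (dsub_add hB)|move=> j _].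
    have [Bj _ _] := he j (ltnW (ltn_ord j)).
    by apply: (dsub_add hB); [|apply: (dsubM hB) => //; apply: (dsub_add hB)];
       do ?apply: (dsubM hB) => //; apply: Bef.
  rewrite [X in J X](_ : _ = (v ^+ p * v ^+ p) * (w ^+ p * x - \sum_(j < s.+1) b j * e j));
    first exact: JM.
  rewrite /z big_ord_recr /= mulrBl mulr_suml (mulrBr _ (w ^+ p * x)) mulrDr mulr_sumr.
  have -> : \sum_(j < s) (v ^+ p * b j + lf (b j) * e s) * e' j =
     \sum_(j < s) (v ^+ p * v ^+ p * (b j * e j)) +
     \sum_(j < s) (v ^+ p * b j * lf (e j) + lf (b j) * (v ^+ p * e j + lf (e j) * e s)) * e s.
    by rewrite -big_split; apply: eq_bigr => j _ /=; rewrite /e'; ring.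
  by rewrite !exprMn; ring.
(* Modulo P, D (e'_j) is v^p D (e_j) + [lf (e j)] D (e_s). A relation among the D (e'_j) is thus one
   among the D (e_j), with the last coefficient read off here. *)
- move=> c Bc Pc j js.
  suff /P_prime[] : P (v ^+ p * c j) by [|move=> /(notPX nPv)].
  have := ind (fun j => if (j < s)%N then v ^+ p * c j else \sum_(l < s) c l * lf (e l)).
  move=> /(_ _ _ j (ltnW js)); rewrite js; apply=> [l|l].
    have Bvp : B (v ^+ p) := dsubX hB v.
    case: ltnP => _; first by apply: dsubM => //; case: (Bc l).
    apply: big_ind; [exact: (dsub0 hB)|by move=> *; apply: (dsub_add hB)|move=> m _].
    have [Bm _ _] := he m (ltnW (ltn_ord m)).
    by apply: dsubM => //; [case: (Bc m) | case: (lfH _ Bm)].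
  rewrite big_ord_recr /= ltnn.
  rewrite [X in P X](_ : _ = \sum_(m < s) c m * D l (e' m) -
     (\sum_(m < s) c m * D l (lf (e m))) * e s).
    by apply: PB; [apply: Pc | apply: PM].
  rewrite !mulr_suml -sumrB -big_split; apply: eq_bigr => m _ /=.
  by rewrite ltn_ord /e' DD der_exppM DM; ring.
- rewrite DD der_exppM DM; apply: PD; first exact: PM.
  by apply: PD; [apply: PM | rewrite mulrC; apply: PM].
exists (w' * v), f0; split=> //; first exact: notPM.
have -> : f0 - (w' * v) ^+ p * f = (f0 - w' ^+ p * (v ^+ p * f + af * e s)) + w' ^+ p * af * e s.
  by rewrite exprMn; ring.
by apply: PD => //; apply: PM.
Qed.

End Lift.

(** * Rings in which strength controls derivatives *)

Section Strength.
Variables (K : fieldType) (S : comNzRingType) (kap : {rmorphism K -> S}) (p : nat).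
Hypothesis charK : p \in [pchar K].
Hypothesis perfK : forall c : K, exists b, b ^+ p = c.
Hypothesis infK : forall q : {poly K}, q != 0 -> exists x, q.[x] != 0.
Hypothesis S_dom : forall x y : S, x * y = 0 -> x = 0 \/ y = 0.
Variable sg : {rmorphism S -> {poly S}}.
Hypothesis gr : grading sg.
Hypothesis hom_kap : forall c, hom sg 0 (kap c).
Hypothesis hom0_kap : forall x, hom sg 0 x -> exists c, x = kap c.
Variables (Y : Type) (tau : Y -> {rmorphism S -> S}).
Hypothesis tau_kap : forall y c, tau y (kap c) = kap c.
Hypothesis tau_low : forall y k x, hom sg k x -> (size (sg (tau y x - x)%R) <= k)%N.
Hypothesis tau_inv : forall x, (forall y, tau y x = x) -> exists c, x = kap c.

(** * Decomposable elements and finite families of generators *)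

Let p_prime : prime p := pcharf_prime charK.

(* The component of degree [k] of the square of the ideal of elements of positive degree. *)
Inductive dec k : S -> Prop :=
| dec0 : dec k 0
| decS x a b i : dec k x -> (0 < i < k)%N -> hom sg i a -> hom sg (k - i) b ->
    dec k (x + a * b).

Lemma dec_mul k a b i : (0 < i < k)%N -> hom sg i a -> hom sg (k - i) b -> dec k (a * b).
Proof. by move=> *; rewrite -[a * b]add0r; apply: (@decS k _ _ _ i) => //; exact: dec0. Qed.

Lemma decD k x y : dec k x -> dec k y -> dec k (x + y).
Proof.
move=> hx; elim=> [|z a b i hz IH hi ha hb]; first by rewrite addr0.
by rewrite addrA; apply: (@decS k _ _ _ i).
Qed.

Lemma decZ k c x : dec k x -> dec k (kap c * x).
Proof.
elim=> [|z a b i hz IH hi ha hb]; first by rewrite mulr0; exact: dec0.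
rewrite mulrDr mulrA; apply: (@decS k _ _ _ i) => //.
by rewrite -[i]add0n; apply: homM.
Qed.

Lemma decN k x : dec k x -> dec k (- x).
Proof. by move=> /(decZ (-1)); rewrite rmorphN1 mulN1r. Qed.

Lemma dec_sum k (R : Type) (r : seq R) (Q : pred R) (F : R -> S) :
  (forall i, Q i -> dec k (F i)) -> dec k (\sum_(i <- r | Q i) F i).
Proof. by move=> h; apply: big_ind => //; [exact: dec0 | exact: decD]. Qed.

(* Generators: the sum over [w i == k] expresses independence in degree [k] modulo [dec]. *)
Definition fam r (e : nat -> S) (w : nat -> nat) :=
  (forall i, (i < r)%N -> (0 < w i)%N /\ hom sg (w i) (e i)) /\
  (forall k (c : nat -> K), dec k (\sum_(i < r | w i == k) kap (c i) * e i) ->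
     forall i, (i < r)%N -> w i = k -> c i = 0).

(** The bound [b] on the new degrees later keeps all generators of P in degrees below that of x. *)
Definition ext b r (e : nat -> S) (w : nat -> nat) r' (e' : nat -> S) (w' : nat -> nat) :=
  [/\ (r <= r')%N, forall i, (i < r)%N -> e' i = e i /\ w' i = w i &
      forall i, (r <= i < r')%N -> (w' i <= b)%N].

Lemma ext_refl b r e w : ext b r e w r e w.
Proof. by split=> // i; case: leqP => // _; rewrite ltnNge => /negPf->. Qed.

Lemma ext_trans b r1 e1 w1 r2 e2 w2 r3 e3 w3 :
  ext b r1 e1 w1 r2 e2 w2 -> ext b r2 e2 w2 r3 e3 w3 -> ext b r1 e1 w1 r3 e3 w3.
Proof.
move=> [r12 h12 b12] [r23 h23 b23]; split=> [|i ir|i /andP[r1i ir3]].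
- exact: leq_trans r23.
- have [-> ->] := h23 i (leq_trans ir r12); exact: h12.
case: (ltnP i r2) => ir2; last by apply: b23; rewrite ir2.
by have [_ ->] := h23 i ir2; apply: b12; rewrite r1i.
Qed.

Lemma ext_le b b' r e w r' e' w' : (b <= b')%N -> ext b r e w r' e' w' -> ext b' r e w r' e' w'.
Proof. by move=> bb' [h1 h2 h3]; split=> // i hi; apply: leq_trans (h3 i hi) bb'. Qed.

Lemma wid_hom r (w : nat -> nat) r' (w' : nat -> nat) k (f : mpoly K r) :
  (r <= r')%N -> (forall i, (i < r)%N -> w' i = w i) ->
  hom (msg K w r) k f -> hom (msg K w' r') k (wid K r r' f).
Proof.
move=> rr' ww'; apply: mev_hom => [c|i ir]; first exact: hom_const.
by rewrite -ww' //; apply: hom_X; apply: leq_trans rr'.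
Qed.

Definition rep r e w k x := exists2 f, hom (msg K w r) k f & mev kap e r f = x.

Lemma rep_ext b r e w r' e' w' k x : ext b r e w r' e' w' -> rep r e w k x -> rep r' e' w' k x.
Proof.
move=> [rr' h _] [f hf <-]; exists (wid K r r' f).
  by apply: wid_hom hf => // i /h[].
by apply: mev_wid => // i /h[].
Qed.

Lemma repD r e w k x y : rep r e w k x -> rep r e w k y -> rep r e w k (x + y).
Proof. by move=> [f hf <-] [g hg <-]; exists (f + g); rewrite ?rmorphD //; apply: homD. Qed.

Lemma repM r e w k l x y : rep r e w k x -> rep r e w l y -> rep r e w (k + l) (x * y).
Proof. by move=> [f hf <-] [g hg <-]; exists (f * g); rewrite ?rmorphM //; apply: homM. Qed.

Lemma rep_kap r e w c : rep r e w 0 (kap c).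
Proof. by exists (mconst r c); [apply: hom_const | rewrite mev_const]. Qed.

Lemma rep_gen r e w i : (i < r)%N -> rep r e w (w i) (e i).
Proof. by move=> ir; exists (mX K r i); [apply: hom_X | rewrite mev_X]. Qed.

Lemma rep0 r e w k : rep r e w k 0.
Proof. by exists 0; [apply: hom0 | rewrite rmorph0]. Qed.

Definition add_last (A : Type) r (e : nat -> A) x i := if i == r then x else e i.

Lemma fam_add r e w k x : fam r e w -> (0 < k)%N -> hom sg k x ->
  (forall c : nat -> K, ~ dec k (x - \sum_(i < r | w i == k) kap (c i) * e i)) ->
  fam r.+1 (add_last r e x) (add_last r w k).
Proof.
rewrite /add_last => -[hw hi] k0 hx nx; split=> [i|l c].
  rewrite ltnS leq_eqVlt => /predU1P[->|ir]; first by rewrite eqxx.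
  by rewrite (ltn_eqF ir); apply: hw.
rewrite big_mkcond big_ord_recr /= !eqxx => hd.
have cE : \sum_(i < r) (if (if i == r :> nat then k else w i) == l then
    kap (c i) * (if i == r :> nat then x else e i) else 0) =
    \sum_(i < r | w i == l) kap (c i) * e i.
  by rewrite [RHS]big_mkcond; apply: eq_bigr => i _; rewrite (ltn_eqF (ltn_ord i)).
rewrite {}cE in hd.
have cr : k = l -> c r = 0.
  move=> kl; rewrite kl eqxx in hd; apply/eqP; apply: contrapT => /negP nz.
  apply: (nx (fun i => - (c r)^-1 * c i)); have := decZ (c r)^-1 hd.
  rewrite mulrDr mulrA -rmorphM mulVf // rmorph1 mul1r addrC mulr_sumr kl => hd'.
  rewrite -sumrN [X in dec l (x + X)](_ : _ = \sum_(i < r | w i == l)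
    kap (c r)^-1 * (kap (c i) * e i)) //.
  by apply: eq_bigr => i _; rewrite rmorphM rmorphN !mulNr opprK mulrA.
have hd' : dec l (\sum_(i < r | w i == l) kap (c i) * e i).
  by move: hd; case: eqP => [/cr->|_]; rewrite ?rmorph0 ?mul0r addr0.
move=> i; rewrite ltnS leq_eqVlt => /predU1P[->|ir]; first by rewrite eqxx => /cr.
by rewrite ltn_eqF //; apply: hi hd' _ ir.
Qed.

Lemma add_last_ext r e w k x : ext k r e w r.+1 (add_last r e x) (add_last r w k).
Proof.
rewrite /add_last; split=> [|i ir|i /andP[ri ir]] //; first by rewrite (ltn_eqF ir).
by rewrite (_ : (i == r) = true) // eqn_leq -ltnS ir.
Qed.

(** S need not be finitely generated, so generators are added on demand. Either x is independent
    modulo decomposables and becomes a generator, or it differs from a combination of generators by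
    products of elements of lower degree. *)
Lemma extend_hom k x r e w : hom sg k x -> fam r e w ->
  exists r' e' w', [/\ ext k r e w r' e' w', fam r' e' w' & rep r' e' w' k x].
Proof.
elim/ltn_ind: k x r e w => k IH x r e w hx hf.
have [k0|k_gt0] := posnP k.
  rewrite k0 in hx *; have [c ->] := hom0_kap hx.
  by exists r, e, w; split=> //; [apply: ext_refl | apply: rep_kap].
have [[c hc]|nc] := pselect (exists c : nat -> K,
    dec k (x - \sum_(i < r | w i == k) kap (c i) * e i)); last first.
  exists r.+1, (add_last r e x), (add_last r w k); split; first exact: add_last_ext.
    by apply: fam_add => // c hc; apply: nc; exists c.
  by have := rep_gen (add_last r e x) (add_last r w k) (ltnSn r); rewrite /add_last eqxx.
have [r' [e' [w' [h1 h2 h3]]]] : exists r' e' w', [/\ ext k r e w r' e' w', fam r' e' w' &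
    rep r' e' w' k (x - \sum_(i < r | w i == k) kap (c i) * e i)].
  elim: hc => [|z a b i hz [r1 [e1 [w1 [h1 h2 h3]]]] /andP[i0 ik] ha hb].
    by exists r, e, w; split=> //; [apply: ext_refl | apply: rep0].
  have [r2 [e2 [w2 [h4 h5 h6]]]] := IH i ik _ _ _ _ ha h2.
  have ki : (k - i < k)%N by rewrite -subn_gt0 subKn // ltnW.
  have [r3 [e3 [w3 [h7 h8 h9]]]] := IH _ ki _ _ _ _ hb h5.
  exists r3, e3, w3; split=> //.
    exact: ext_trans (ext_trans h1 (ext_le (ltnW ik) h4)) (ext_le (ltnW ki) h7).
  apply: repD; first exact: rep_ext h7 (rep_ext h4 h3).
  by rewrite -{1}(subnKC (ltnW ik)); apply: repM => //; apply: rep_ext h7 h6.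
exists r', e', w'; split=> //.
rewrite -[x](subrK (\sum_(i < r | w i == k) kap (c i) * e i)); apply: repD => //.
apply: (big_ind (rep r' e' w' k)); [exact: rep0|by move=> *; apply: repD|].
move=> i /eqP wi; apply: (rep_ext h1); rewrite -[k]add0n; apply: repM; first exact: rep_kap.
by rewrite -wi; apply: rep_gen.
Qed.

Lemma extend_homs m b (t : nat -> S) (u : nat -> nat) r e w :
  (forall j, (j < m)%N -> (u j <= b)%N /\ hom sg (u j) (t j)) -> fam r e w ->
  exists r' e' w', [/\ ext b r e w r' e' w', fam r' e' w' &
    forall j, (j < m)%N -> rep r' e' w' (u j) (t j)].
Proof.
elim: m => [|m IH] ht hf; first by exists r, e, w; split=> //; apply: ext_refl.
have [j jm|r1 [e1 [w1 [h1 h2 h3]]]] := IH _ hf; first exact/ht/ltnW.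
have [ub um] := ht m (ltnSn m).
have [r2 [e2 [w2 [h4 h5 h6]]]] := extend_hom um h2.
exists r2, e2, w2; split=> //; first exact: ext_trans h1 (ext_le ub h4).
move=> j; rewrite ltnS leq_eqVlt => /predU1P[-> //|jm].
by apply: rep_ext h4 _; apply: h3.
Qed.

Definition arep r e w (x : S) :=
  exists2 f, (size (msg K w r f) <= size (sg x))%N & mev kap e r f = x.

Lemma arep_ext b r e w r' e' w' x : ext b r e w r' e' w' -> arep r e w x -> arep r' e' w' x.
Proof.
move=> [rr' h _] [f hf fE]; exists (wid K r r' f); last first.
  by rewrite -fE; apply: mev_wid => // i /h[].
apply: (leq_trans _ hf); rewrite (_ : msg K w' r' _ = map_poly (wid K r r') (msg K w r f)).
  exact: size_poly.
apply: mev_msg => [c|i ir]; first exact: hom_const.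
by have [_ <-] := h i ir; apply/hom_X/(leq_trans ir).
Qed.

Lemma extend m (x : nat -> S) r e w : fam r e w ->
  exists b r' e' w', [/\ ext b r e w r' e' w', fam r' e' w' &
    forall j, (j < m)%N -> arep r' e' w' (x j)].
Proof.
move=> hf; elim: m => [|m [b [r1 [e1 [w1 [h1 h2 h3]]]]]].
  by exists 0%N, r, e, w; split=> //; apply: ext_refl.
have [|r2 [e2 [w2 [h4 h5 h6]]]] := @extend_homs (size (sg (x m))) (size (sg (x m)))
  (fun k => (sg (x m))`_k) id _ _ _ _ h2.
  by move=> j jm; split; [apply: ltnW | apply: gr.2].
exists (maxn b (size (sg (x m)))), r2, e2, w2; split=> //.
  apply: ext_trans (ext_le _ h1) (ext_le _ h4); [exact: leq_maxl | exact: leq_maxr].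
move=> j; rewrite ltnS leq_eqVlt => /predU1P[->|jm]; last by apply: arep_ext h4 _; apply: h3.
have /fin_all_exists[f fH] : forall k : 'I_(size (sg (x m))), exists f : mpoly K r2,
    hom (msg K w2 r2) k f /\ mev kap e2 r2 f = (sg (x m))`_k.
  by move=> k; have [f] := h6 k (ltn_ord k); exists f.
exists (\sum_k f k).
  rewrite rmorph_sum (leq_trans (size_sum _ _ _)) //; apply/bigmax_leqP=> k _.
  by rewrite (leq_trans (hom_size (fH k).1)).
rewrite rmorph_sum [RHS](sum_hc gr (leqnn _)).
by apply: eq_bigr => k _; case: (fH k).
Qed.

(** * Algebraic independence of generators *)

Lemma linear_part r e w (f : mpoly K r) k :
  (forall i, (i < r)%N -> (0 < w i)%N /\ hom sg (w i) (e i)) -> (0 < k)%N ->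
  dec k (mev kap e r (msg K w r f)`_k -
    \sum_(i < r | w i == k) kap (mev idfun (fun=> 0) r (pderiv i f)) * e i).
Proof.
move=> hw; have w0 i : (i < r)%N -> (0 < w i)%N by move=> /hw[].
have he i : (i < r)%N -> hom sg (w i) (e i) by move=> /hw[].
elim/mpoly_ind: f k => [c|j jr|f g Hf Hg|f g Hf Hg] k k0.
- rewrite (coef_hom _ (hom_const _ _ _)) gtn_eqF // rmorph0 sub0r big1.
    by rewrite oppr0; apply: dec0.
  by move=> i _; rewrite pderiv_const !rmorph0 mul0r.
- rewrite (coef_hom _ (hom_X _ _ jr)) (eq_bigr (fun i : 'I_r => (i == Ordinal jr)%:R * e i)).
    rewrite eq_sym; case: eqP => wj.
      rewrite (bigD1 (Ordinal jr)) /= ?wj // eqxx mul1r mulr1n mev_X // big1 ?addr0.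
        by rewrite subrr; apply: dec0.
      by move=> i /andP[_ /negPf->]; rewrite mul0r.
    rewrite mulr0n rmorph0 sub0r big1 ?oppr0; first exact: dec0.
    by move=> i /eqP wi; case: eqP => [ij|_]; [rewrite ij in wi|rewrite mul0r].
  by move=> i _; rewrite pderiv_X // !rmorph_nat.
- rewrite rmorphD coefD rmorphD (eq_bigr (fun i : 'I_r =>
    kap (mev idfun (fun=> 0) r (pderiv i f)) * e i +
    kap (mev idfun (fun=> 0) r (pderiv i g)) * e i)).
    rewrite big_split /= opprD addrACA; apply: decD; [exact: Hf | exact: Hg].
  by move=> i _; rewrite pderivD !rmorphD mulrDl.
- pose z (h : mpoly K r) := kap (mev idfun (fun=> 0) r h).
  (* The two outer terms of the convolution contain f (0) and g (0) and match the product rule; the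
     inner ones are decomposable. *)
  rewrite rmorphM coefM big_ord_recl subn0 coef0_msg //.
  case: k k0 => // k _; rewrite big_ord_recr /= /bump /= add1n subnn coef0_msg //.
  rewrite rmorphD rmorphD !rmorphM rmorph_sum !mev_const.
  rewrite (eq_bigr (fun i : 'I_r => z f * (z (pderiv i g) * e i) +
       z g * (z (pderiv i f) * e i))); last first.
    by move=> i _; rewrite /z pderivM !rmorphD !rmorphM; ring.
  rewrite big_split /= -!mulr_sumr.
  set A := \sum_(i < k) _; set a := mev kap e r _; set b := mev kap e r _.
  set s1 := \sum_(i < r | _) _; set s2 := \sum_(i < r | _) _.
  have -> : kap (mev idfun (fun=> 0) r f) * a +
      (A + b * kap (mev idfun (fun=> 0) r g)) - (z f * s1 + z g * s2) =
      z f * (a - s1) + z g * (b - s2) + A by rewrite /z; ring.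
  apply: decD; first apply: decD.
  + by apply: decZ; apply: Hg.
  + by apply: decZ; apply: Hf.
  apply: dec_sum => i _; rewrite rmorphM add1n subSS; apply: (@dec_mul _ _ _ i.+1).
  + by rewrite !ltnS ltn_ord.
  + by apply: mev_hom he _ => //; apply: (msg_grading K w r).2.
  by rewrite subSS; apply: mev_hom he _ => //; apply: (msg_grading K w r).2.
Qed.

Lemma alg_indep_hom k r e w (f : mpoly K r) : fam r e w -> hom (msg K w r) k f ->
  mev kap e r f = 0 -> f = 0.
Proof.
elim/ltn_ind: k r e w f => k IH r e w f hfam hf ef.
(* The induction hypothesis for all families, since expressing translates requires new
   generators. *)
have low r' e' w' (g : mpoly K r') : fam r' e' w' -> (size (msg K w' r' g) <= k)%N ->
    mev kap e' r' g = 0 -> g = 0.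
  move=> hfam' sg_le eg; rewrite (sum_hc (msg_grading K w' r') sg_le).
  apply: big1 => l _; apply: (IH l _ _ e' w') => //; first exact: (msg_grading K w' r').2.
  have := mev_msg (sg := sg) (phi := kap) (x := e') (w := w') g hom_kap.
  move=> /(_ (fun i ir => (hfam'.1 i ir).2)); rewrite eg rmorph0 => /polyP/(_ l).
  by rewrite coef0 coef_map.
have [k0|k_gt0] := posnP k.
  have fE : f = mconst r (mev idfun (fun=> 0) r f).
    rewrite -(coef0_msg (w := w)) => [|i /hfam.1[]//].
    by rewrite (coef_hom _ hf) k0.
  rewrite fE; move: ef; rewrite {1}fE mev_const => /eqP; rewrite fmorph_eq0 => /eqP->.
  by rewrite rmorph0.
apply/eqP; apply: contrapT => /negP nz_f.
have [/forallP df0|/forallPn[j0 nz0]] := boolP [forall i : 'I_r, pderiv i f == 0].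
  have [i ir|g gE] := pth_root charK perfK (f := f).
    by apply/eqP; apply: (df0 (Ordinal ir)).
  case/negP: nz_f; rewrite -gE (_ : g = 0) ?expr0n ?gtn_eqF ?prime_gt0 //.
  have S0X (x : S) n : x ^+ n = 0 -> x = 0.
    elim: n => [|n IHn]; first by move/eqP; rewrite expr0 oner_eq0.
    by rewrite exprS => /S_dom[].
  apply: (low _ e w) => //; last by apply: (S0X _ p); rewrite -rmorphXn gE.
  have /orP[lt_s|/eqP->] := mpoly_size_exp (msg K w r g) (prime_gt0 p_prime); last by rewrite size_poly0.
  rewrite -rmorphXn gE in lt_s; have := leq_trans lt_s (hom_size hf); rewrite ltnS.
  case: (size _) => // s /=; case: s => // s H; apply: leq_trans H.
  by rewrite ltn_Pmulr // prime_gt1.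
pose j := [arg max_(i > j0 | pderiv i f != 0) w i].
have [nzj maxj] : pderiv j f != 0 /\ forall i : 'I_r, pderiv i f != 0 -> (w i <= w j)%N.
  by rewrite /j; case: arg_maxnP.
move: (ltn_ord j) nzj maxj; move: (j : nat) => {}j jr nzj maxj.
have wjk : (w j <= k)%N.
  rewrite leqNgt; apply/negP=> kw; case/eqP: nzj.
  exact: size_pderiv_msg (hom_size hf) kw.
have hg : hom (msg K w r) (k - w j) (pderiv j f) by apply: hom_pderiv; rewrite // subnK.
have [c cE] : exists c, mev kap e r (pderiv j f) = kap c.
  apply: tau_inv => y.
  have [b [r' [e' [w' [[rr' hext _] hfam' hl]]]]] := extend r (fun i => tau y (e i) - e i) hfam.
  have /boolp.choice[q qH] : forall i, exists q : mpoly K r', (i < r)%N ->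
      (size (msg K w' r' q) <= w i)%N /\ mev kap e' r' q = tau y (e i) - e i.
    move=> i; have [ir|_] := ltnP i r; last by exists 0.
    have [q sq qE] := hl i ir; exists q => _; split=> //.
    by apply: leq_trans sq _; apply/tau_low/(hfam.1 i ir).2.
  (* The translation in coordinates: X_i is moved by q_i, of degree below w_i. *)
  pose x i := mX K r' i + q i.
  have evx g : mev kap e' r' (mev (mconst r') x r g) = tau y (mev kap e r g).
    rewrite (mev_comp (phi' := kap)) => [|c]; last by rewrite mev_const.
    rewrite (mev_comp (phi' := kap)) => [|c]; last by rewrite tau_kap.
    apply: eq_mev => i ir /=; rewrite /x rmorphD mev_X ?(leq_trans ir) //.
    by have [-> _] := hext i ir; have [_ ->] := qH i ir; rewrite addrC subrK.
  (* Both sides vanish at e' and have the same leading form, so their difference is a relation of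
     smaller degree. *)
  have xf : mev (mconst r') x r f = wid K r r' f.
    apply/eqP; rewrite -subr_eq0; apply/eqP; apply: (low _ e' w') => //; last first.
      rewrite rmorphB evx ef rmorph0 (@mev_wid _ _ kap e) ?ef ?subrr // => i /hext[] //.
    apply: size_top_sub; last by apply: wid_hom hf => // i /hext[].
    apply: mev_top hf => [c|i ir]; first exact: hom_const.
    have [_ <-] := hext i ir; have [sq _] := qH i ir.
    rewrite -[X in top _ _ _ X]addr0 /x; apply: topD.
      by apply/top_hom/hom_X/(leq_trans ir).
    have [_ ->] := hext i ir.
    by split; [apply: leq_trans sq _ | rewrite nth_default].
  (* Differentiate the invariance of f along X_j. By maximality of w_j, every q_i with nonzero
     df/dX_i has degree below w_j and does not involve X_j. *)
  have dxf : mev (mconst r') x r (pderiv j f) = wid K r r' (pderiv j f).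
    rewrite -pderiv_wid // -xf.
    rewrite (@chain_rule _ _ (mconst r') x (@pderiv K r' j)); first last.
    - exact: pderiv_const.
    - exact: pderivM.
    - exact: pderivD.
    have dq i : (i < r)%N -> (w i <= w j)%N -> pderiv j (q i) = 0.
      move=> ir wij; have [sq _] := qH i ir.
      apply: size_pderiv_msg sq _; first exact: leq_trans rr'.
      by have [_ ->] := hext j jr.
    rewrite (bigD1 (Ordinal jr)) //= /x pderivD pderiv_X ?(leq_trans jr) // eqxx dq // addr0 mulr1.
    rewrite big1 ?addr0 // => i; rewrite -val_eqE /= => ne.
    have [->|nzi] := eqVneq (pderiv i f) 0; first by rewrite rmorph0 mul0r.
    by rewrite pderivD pderiv_X ?(leq_trans (ltn_ord i)) // dq ?maxj // eq_sym (negPf ne) addr0 mulr0.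
  by rewrite -evx dxf; apply: mev_wid => // i /hext[].
have gc : pderiv j f = mconst r c.
  apply/eqP; rewrite -subr_eq0; apply/eqP; apply: (low _ e w) => //; last first.
    by rewrite rmorphB cE mev_const subrr.
  rewrite rmorphB (leq_trans (size_polyD _ _)) // size_polyN geq_max.
  have lt_k : (k - w j < k)%N by rewrite ltn_subrL (hfam.1 j jr).1.
  by rewrite (leq_trans (hom_size hg)) // (leq_trans (hom_size (hom_const _ _ _))).
have wk : w j = k.
  apply/eqP; rewrite eqn_leq wjk leqNgt -subn_gt0; apply/negP=> lt_wk.
  have hg0 : hom (msg K w r) 0 (pderiv j f) by rewrite gc; apply: hom_const.
  by case/eqP: nzj; apply: hom_uniq hg hg0 _; rewrite -lt0n.
(* In the linear part of the relation e_j has the nonzero coefficient c, against independence modulo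
   decomposables. *)
have := linear_part f hfam.1 k_gt0; rewrite (coef_hom _ hf) eqxx mulr1n ef sub0r => /decN.
rewrite opprK => hd.
have := hfam.2 k (fun i => mev idfun (fun=> 0) r (pderiv i f)) hd j jr wk.
by rewrite gc mev_const /= => c0; case/eqP: nzj; rewrite gc c0 rmorph0.
Qed.

Lemma alg_indep r e w (f : mpoly K r) : fam r e w -> mev kap e r f = 0 -> f = 0.
Proof.
move=> hfam ef; rewrite [LHS](sum_hc (msg_grading K w r) (leqnn (size (msg K w r f)))).
apply: big1 => l _; apply: (alg_indep_hom (e := e) (w := w) (k := l)) => //.
  exact: (msg_grading K w r).2.
have := mev_msg (sg := sg) (phi := kap) (x := e) (w := w) f hom_kap.
move=> /(_ (fun i ir => (hfam.1 i ir).2)); rewrite ef rmorph0 => /polyP/(_ l).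
by rewrite coef0 coef_map.
Qed.

(** * Reduction modulo the ideal of the first generators *)

Definition kill R r : {rmorphism mpoly K R -> mpoly K R} :=
  mev (mconst R) (fun i => if (i < r)%N then 0 else mX K R i) R.

Lemma idl_agree r (e e' : nat -> S) x : (forall i, (i < r)%N -> e' i = e i) ->
  idl r e x -> idl r e' x.
Proof. by move=> h [a ->]; exists a; apply: eq_bigr => i _; rewrite h. Qed.

Lemma kill_idl R r e (f : mpoly K R) : (r <= R)%N -> kill R r f = 0 ->
  idl r e (mev kap e R f).
Proof.
move=> rR f0; suff: idl r e (mev kap e R f - mev kap e R (kill R r f)).
  by rewrite f0 rmorph0 subr0.
elim/mpoly_ind: {f0} f => [c|i iR|f g Hf Hg|f g Hf Hg].
- by rewrite /kill !mev_const subrr; apply: idl0.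
- rewrite /kill !mev_X //; case: ifP => ir; last by rewrite mev_X // subrr; apply: idl0.
  by rewrite rmorph0 subr0; apply: idl_gen.
- by rewrite !rmorphD opprD addrACA; apply: idlD.
- rewrite !rmorphM; set a := mev _ _ _ f in Hf *; set b := mev _ _ _ g in Hg *.
  set a' := mev _ _ _ _ in Hf *; set b' := mev _ _ _ _ in Hg *.
  have -> : a * b - a' * b' = (a - a') * b + a' * (b - b') by ring.
  by apply: idlD; [apply: idlMr | apply: idlMl].
Qed.

(** The family is enlarged until the coefficients of the membership are polynomials in it; algebraic
    independence then makes the membership a polynomial identity. *)
Lemma idl_kill R r e w (f : mpoly K R) : (r <= R)%N -> fam R e w ->
  idl r e (mev kap e R f) -> kill R r f = 0.
Proof.
move=> rR hfam [a fE].
have [b [R' [e' [w' [[RR' hext _] hfam' ha]]]]] := extend r a hfam.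
have /boolp.choice[al alE] : forall j, exists q : mpoly K R', (j < r)%N -> mev kap e' R' q = a j.
  by move=> j; have [/ha[q _ <-]|_] := ltnP j r; [exists q | exists 0].
have wE : wid K R R' f = \sum_(j < r) al j * mX K R' j.
  apply/eqP; rewrite -subr_eq0; apply/eqP; apply: (alg_indep hfam').
  rewrite rmorphB (@mev_wid _ _ kap e) // => [|i /hext[] //].
  apply/eqP; rewrite subr_eq0 fE rmorph_sum; apply/eqP; apply: eq_bigr => j _.
  have jR : (j < R)%N := leq_trans (ltn_ord j) rR.
  by rewrite rmorphM alE // mev_X ?(leq_trans jR) //; have [-> _] := hext j jR.
apply: (wid_inj RR'); rewrite rmorph0.
have -> : wid K R R' (kill R r f) = kill R' r (wid K R R' f).
  rewrite /kill /wid (mev_comp (phi' := mconst R')) => [|c]; last by rewrite mev_const.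
  rewrite [RHS](mev_comp (phi' := mconst R')) => [|c]; last by rewrite mev_const.
  apply: eq_mev => i iR /=; have iR' := leq_trans iR RR'; rewrite mev_X //.
  by case: (i < r)%N; rewrite ?rmorph0 // mev_X.
rewrite wE rmorph_sum big1 // => j _; rewrite rmorphM {2}/kill mev_X ?ltn_ord ?mulr0 //.
by apply: leq_trans (ltn_ord j) (leq_trans rR RR').
Qed.

Lemma idl_prime r e w x y : fam r e w -> idl r e (x * y) -> idl r e x \/ idl r e y.
Proof.
move=> hfam hxy.
have [b [R [e' [w' [[rR hext _] hfam' hr]]]]] :=
  extend 2 (fun i => if i == 0%N then x else y) hfam.
have ee i : (i < r)%N -> e i = e' i by move=> /hext[].
have ee' i : (i < r)%N -> e' i = e i by move=> /hext[].
have [/= f _ fE] := hr 0%N isT; have [/= g _ gE] := hr 1%N isT.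
have : kill R r (f * g) = 0.
  by apply: (idl_kill rR hfam'); rewrite rmorphM fE gE; apply: idl_agree hxy.
rewrite rmorphM => /mpoly_mulf_eq0[] /(kill_idl e' rR) /(idl_agree ee).
  by rewrite fE; left.
by rewrite gE; right.
Qed.

Lemma idl_proper r e w : fam r e w -> ~ idl r e 1.
Proof.
move=> hfam h1; have : kill r r 1 = 0 by apply: (idl_kill (leqnn r) hfam); rewrite rmorph1.
by rewrite rmorph1 => /eqP; rewrite oner_eq0.
Qed.

(** * Derivatives of indecomposable elements *)

Variables (I : Type) (D : I -> S -> S).
Hypothesis DD : forall i x y, D i (x + y) = D i x + D i y.
Hypothesis DM : forall i x y, D i (x * y) = D i x * y + x * D i y.
Hypothesis DC : forall i j x, D i (D j x) = D j (D i x).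
Hypothesis Dp : forall i x, iter p (D i) x = 0.
Hypothesis D_hom : forall i k x, hom sg k.+1 x -> hom sg k (D i x).
Hypothesis D_kap : forall i c, D i (kap c) = 0.
Hypothesis D_poincare : forall r e (u : nat -> nat) x,
  (forall j, (j < r)%N -> hom sg (u j) (e j)) ->
  (forall i, idl r (fun j => e j ^+ p) (D i x)) ->
  exists g, idl r (fun j => e j ^+ p) (x - g ^+ p).

(** Number and degrees of the generators are unrestricted, because the induction meets ideals of
    uncontrolled size. *)
Definition strong n := forall x, hom sg n x -> ~ dec n x ->
  forall R t (u : nat -> nat), (forall j, (j < R)%N -> (0 < u j)%N /\ hom sg (u j) (t j)) ->
  ~ (forall i, idl R t (D i x)).

Lemma D_lin i r (c : nat -> K) (e : nat -> S) :
  D i (\sum_(j < r) kap (c j) * e j) = \sum_(j < r) kap (c j) * D i (e j).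
Proof.
rewrite (der_sum DD); apply: eq_bigr => j _; by rewrite DM D_kap mul0r add0r.
Qed.

Lemma idl_coef r t (u : nat -> nat) x m : (forall j, (j < r)%N -> hom sg (u j) (t j)) ->
  idl r t x -> idl r t (sg x)`_m.
Proof.
move=> ht [a ->]; rewrite rmorph_sum coef_sum; apply: idl_sum => j _.
rewrite (coef_sgM _ _ (ht _ _)) //; case: leqP => _; last exact: idl0.
exact/idlMl/idl_gen.
Qed.

(* Along the line [X_i = a_i * t] through a point where some coefficient does not
   vanish, the lowest coefficients in [t] turn a linear relation into one over [K]. *)
Lemma D_indep n r e w (c : nat -> S) : (forall k, (0 < k < n)%N -> strong k) ->
  fam r e w -> (forall j, (j < r)%N -> (w j < n)%N) ->
  (forall i, idl r e (\sum_(j < r) c j * D i (e j))) ->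
  forall j, (j < r)%N -> idl r e (c j).
Proof.
move=> IH hfam wn hD j0 j0r; apply: contrapT => nj0.
have [b [R [e1 [w1 [[rR hext _] hfam1 hc]]]]] := extend r c hfam.
have /boolp.choice[ga gaE] : forall j, exists q : mpoly K R, (j < r)%N -> mev kap e1 R q = c j.
  by move=> j; have [/hc[q _ <-]|_] := ltnP j r; [exists q | exists 0].
have [a nza] : exists a, mev idfun a R (kill R r (ga j0)) != 0.
  apply: nonvanishing_point => //; apply/eqP => /(kill_idl e1 rR); rewrite gaE // => h.
  by apply: nj0; apply: idl_agree h => i /hext[].
(* The point lies where the first r variables vanish, so reduction modulo their ideal is not felt on
   the line. *)
pose a' i := if (i < r)%N then 0 else a i.
have {}nza : mev idfun a' R (ga j0) != 0.
  move: nza; rewrite /kill (mev_comp (phi' := idfun)) => [|?]; last by rewrite mev_const.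
  rewrite (@eq_mev _ _ _ _ a') // => i iR /=; rewrite /a'; case: ifP => _; first by rewrite rmorph0.
  by rewrite mev_X.
pose la j : {poly K} := mev polyC (fun i => (a' i)%:P * 'X) R (ga j).
have exm : exists m, [exists j : 'I_r, (la j)`_m != 0].
  have nzla : la j0 != 0.
    apply: contraNneq nza => la0.
    suff <- : (la j0).[1] = mev idfun a' R (ga j0) by rewrite la0 horner0.
    rewrite -[_.[1]]/(horner_eval 1 (la j0)) /la (mev_comp (phi' := idfun)).
      by apply: eq_mev => i _ /=; rewrite /horner_eval hornerMX mulr1 hornerC.
    by move=> d; rewrite /= /horner_eval hornerC.
  exists (size (la j0)).-1; apply/existsP; exists (Ordinal j0r) => /=.
  by rewrite -lead_coefE lead_coef_eq0.
case: (ex_minnP exm) => de /existsP[j1 nzj1] min_de {exm}.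
pose ka j := (la j)`_de.
have la_low j m : (j < r)%N -> (m < de)%N -> (la j)`_m = 0.
  move=> jr md; apply/eqP; apply: contraLR md => nz; rewrite -leqNgt.
  by apply: min_de; apply/existsP; exists (Ordinal jr).
have key i : idl R e1 (D i (\sum_(j < r) kap (ka j) * e j)).
  have [b2 [R2 [e2 [w2 [[RR2 hext2 _] hfam2 hq]]]]] := extend r (fun j => D i (e j)) hfam1.
  have /boolp.choice[q qE] : forall j, exists q : mpoly K R2, (j < r)%N ->
      mev kap e2 R2 q = D i (e j).
    by move=> j; have [/hq[q _ <-]|_] := ltnP j r; [exists q | exists 0].
  have ee2 l : (l < R)%N -> e1 l = e2 l by move=> /hext2[].
  have rR2 := leq_trans rR RR2.
  (* [Psi] puts the first R variables on the line and keeps the new ones, which may occur in the D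
     (e_j) but not in the c_j. *)
  pose Psi : {rmorphism mpoly K R2 -> {poly mpoly K R2}} := mev (polyC \o mconst R2)
    (fun l => if (l < R)%N then (mconst R2 (a' l))%:P * 'X else (mX K R2 l)%:P) R2.
  have Psi0 : \sum_(j < r) Psi (wid K R R2 (ga j)) * Psi (q j) = 0.
    have PsiK f : Psi (kill R2 r f) = Psi f.
      rewrite /Psi /kill (mev_comp (phi' := polyC \o mconst R2)) => [|d]; last by rewrite mev_const.
      apply: eq_mev => l lR2 /=; case: ltnP => lr; last by rewrite mev_X.
      by rewrite rmorph0 (leq_trans lr rR) /a' lr rmorph0 polyC0 mul0r.
    under eq_bigr do rewrite -rmorphM; rewrite -rmorph_sum -PsiK.
    rewrite (idl_kill rR2 hfam2) ?rmorph0 // rmorph_sum.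
    apply: (@idl_agree r e); first by move=> l lr; rewrite -ee2 ?(leq_trans lr) //; have [] := hext l lr.
    rewrite (eq_bigr (fun j : 'I_r => c j * D i (e j))) // => j _.
    by rewrite rmorphM qE // (@mev_wid _ _ kap e1) ?gaE // => l /hext2[].
  have Psi_la (j : 'I_r) : Psi (wid K R R2 (ga j)) = map_poly (mconst R2) (la j).
    rewrite /wid (mev_comp (phi' := polyC \o mconst R2)) => [|d]; last by rewrite /Psi mev_const.
    rewrite [RHS](mev_comp (phi' := polyC \o mconst R2)) => [|d]; last by rewrite /= map_polyC.
    apply: eq_mev => l lR /=; have lR2 := leq_trans lR RR2; rewrite /Psi mev_X // lR.
    by rewrite rmorphM /= map_polyC map_polyX.
  have Psi_0 f : (Psi f)`_0 = kill R2 R f.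
    rewrite -horner_coef0 -[_.[0]]/(horner_eval 0 (Psi f)) /Psi (mev_comp (phi' := mconst R2)).
      apply: eq_mev => l _ /=; rewrite /horner_eval; case: ifP => _; last by rewrite hornerC.
      by rewrite hornerMX mulr0.
    by move=> d; rewrite /= /horner_eval hornerC.
  apply: (@idl_agree R e2) => //; rewrite D_lin.
  rewrite (_ : \sum_(j < r) _ = mev kap e2 R2 (\sum_(j < r) mconst R2 (ka j) * q j)); last first.
    by rewrite rmorph_sum; apply: eq_bigr => j _; rewrite rmorphM mev_const qE.
  apply: kill_idl => //; rewrite rmorph_sum.
  have /polyP/(_ de) := Psi0; rewrite coef0 coef_sum => E; rewrite -[RHS]E.
  apply: eq_bigr => j _; rewrite rmorphM {1}/kill mev_const -Psi_0 Psi_la coefM.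
  rewrite (bigD1 ord_max) //= subnn coef_map /= big1 ?addr0 //.
  move=> m; rewrite -val_eqE /= => ne.
  have md : (m < de)%N by rewrite ltn_neqAle ne -ltnS ltn_ord.
  by rewrite coef_map la_low // raddf0 mul0r.
(* The part of degree k of the combination contains e_j1 with nonzero coefficient, so it is
   indecomposable, and [strong k] applies to it. *)
pose k := w j1; have k_gt0 : (0 < k)%N := (hfam.1 j1 (ltn_ord j1)).1.
pose x := \sum_(j < r | w j == k) kap (ka j) * e j.
have hx : hom sg k x.
  apply: hom_sum => j /eqP <-; rewrite -[w j]add0n.
  by apply: homM => //; apply: (hfam.1 j _).2.
have nx : ~ dec k x.
  by move=> /(hfam.2 k)/(_ j1 (ltn_ord j1) (erefl k))/eqP; rewrite (negPf nzj1).
apply: (IH k _ x hx nx R e1 w1 (hfam1.1)); first by rewrite k_gt0 wn.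
move=> i; have he1 l : (l < R)%N -> hom sg (w1 l) (e1 l) by move=> /hfam1.1[].
have := idl_coef k.-1 he1 (key i); rewrite D_lin rmorph_sum coef_sum.
rewrite (_ : \sum_(j < r) _ = D i x) //.
rewrite /x (der_sum DD) [RHS]big_mkcond; apply: eq_bigr => j _.
have [wj0 hej] := hfam.1 j (ltn_ord j).
have hDe : hom sg (w j).-1 (kap (ka j) * D i (e j)).
  by rewrite -[_.-1]add0n; apply: homM => //; apply: D_hom; rewrite prednK.
rewrite (coef_hom _ hDe) -(eqn_add2r 1) !addn1 !prednK // eq_sym.
by case: eqP => _; rewrite ?mulr1n ?mulr0n // DM D_kap mul0r add0r.
Qed.

Lemma strong_all n : (0 < n)%N -> strong n.
Proof.
elim/ltn_ind: n => n IH n_gt0 x hx nx R t u ht hD.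
have fam0 : fam 0 (fun=> 0) (fun=> 0%N) by [].
(* D x has degree n - 1, so generators of degree n or more cannot contribute. *)
pose t' j := if (u j < n)%N then t j else 0.
pose u' j := if (u j < n)%N then u j else 0%N.
have [|r [e [w [[_ _ wn] hfam hr]]]] := @extend_homs R n.-1 t' u' _ _ _ _ fam0.
  move=> j jR; rewrite /t' /u'; case: ifP => un; last by split=> //; apply: hom0.
  by split; [rewrite -ltnS prednK | apply: (ht j jR).2].
have {}wn j : (j < r)%N -> (w j < n)%N by move=> jr; have := wn j jr; rewrite -ltnS prednK.
have he j : (j < r)%N -> hom sg (w j) (e j) by move=> /hfam.1[].
have charS : p \in [pchar S] := rmorph_pchar kap charK.
have {hD} hD i : idl r e (D i x).
  have ht2 j : (j < R)%N -> hom sg (u j) (t j) by move=> /ht[].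
  have [|a [_ a0 ->]] := idl_hom gr ht2 (m := n.-1) _ (hD i).
    by apply: D_hom; rewrite prednK.
  apply: idl_sum => j _; have [un|nu] := ltnP (u j) n; last first.
    by rewrite a0 ?mul0r ?prednK //; apply: idl0.
  apply: idlMl; have [f hf fE] := hr j (ltn_ord j).
  rewrite /t' /u' un in fE hf; rewrite -fE; apply: kill_idl => //.
  (* A polynomial of positive degree has no constant term, so t_j lies in the ideal of the e_i. *)
  have -> : kill r r f = mconst r (mev idfun (fun=> 0) r f).
    rewrite (mev_comp (phi' := mconst r)) => [|d //]; apply: eq_mev => i' ir /=.
    by rewrite ir rmorph0.
  rewrite -(coef0_msg (w := w)) => [|i' /hfam.1[]//].
  by rewrite (coef_hom _ hf) eq_sym gtn_eqF // (ht j (ltn_ord j)).1.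
pose J := idl r (fun j => e j ^+ p).
have JP y : J y -> idl r e y.
  apply: idl_sub => j jr; rewrite -(prednK (prime_gt0 p_prime)) exprS.
  exact/idlMr/idl_gen.
have J_D i y : J y -> J (D i y).
  move=> [a ->]; rewrite (der_sum DD); apply: idl_sum => j _.
  rewrite DM (der_expp charS DM) mulr0 addr0.
  exact/idlMl/(idl_gen (fun j => e j ^+ p)).
have [||||w0 [f0 [nw0 Pf0 Jf0]]] := @lift_to_constants S p I D charS DD DM DC Dp
   (idl r e) J (@idl0 _ r e) (@idlD _ r e) (fun a y => @idlMl _ r e a y) (idl_proper hfam)
   (fun a y => @idl_prime r e w a y hfam)
   (@idlD _ r _) (fun a y => @idlMl _ r _ a y) J_D JP r (fun=> True) e x _ _ _ _ Logic.I hD.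
- by split.
- by move=> j jr; split=> //; apply: (idl_gen _ jr) || apply: (idl_gen (fun j => e j ^+ p) jr).
- exists 1; first exact: idl_proper hfam.
  move=> y _ [a yE]; exists a => //; rewrite expr1n mul1r -yE subrr; exact: idl0.
- move=> c _ hc j jr; apply: D_indep hfam wn hc j jr => k /andP[k0 kn]; exact: IH.
have [g Jg] := D_poincare he Jf0.
have Pwg : idl r e (w0 ^+ p * x - g ^+ p).
  have -> : w0 ^+ p * x - g ^+ p = (f0 - g ^+ p) - (f0 - w0 ^+ p * x) by ring.
  by apply: idlB => //; apply: JP.
(* No e_j has degree n, so indecomposability of x suffices for x to join the family. *)
have hfam1 : fam r.+1 (add_last r e x) (add_last r w n).
  apply: fam_add => // c; rewrite big1 ?subr0 // => j /eqP wj.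
  by have := wn j (ltn_ord j); rewrite wj ltnn.
have [b [R1 [e1 [w1 [[rR hext _] hfam2 hr1]]]]] :=
  extend 2 (fun i => if i == 0%N then w0 else g) hfam1.
have [/= al _ alE] := hr1 0%N isT; have [/= be _ beE] := hr1 1%N isT.
have e1e i : (i < r)%N -> e1 i = e i.
  by move=> ir; have [-> _] := hext i (ltnW ir); rewrite /add_last (ltn_eqF ir).
have ee1 i : (i < r)%N -> e i = e1 i by move/e1e.
have e1r : e1 r = x by have [-> _] := hext r (ltnSn r); rewrite /add_last eqxx.
(* Modulo P this is w0^p X_r = g^p. Its derivative along X_r is w0^p = 0, which puts w0 in P. *)
have : kill R1 r (al ^+ p * mX K R1 r - be ^+ p) = 0.
  apply: (idl_kill (ltnW rR) hfam2); rewrite rmorphB rmorphM !rmorphXn mev_X // alE beE e1r.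
  exact: idl_agree Pwg.
rewrite rmorphB rmorphM !rmorphXn {2}/kill mev_X // ltnn => /(congr1 (pderiv r)).
rewrite pderivB pderivM pderiv_X // eqxx !(pderiv_exp_p charK) mul0r add0r mulr1 subr0 pderiv0.
move=> al0; apply: nw0; rewrite -alE; apply: (idl_agree ee1); apply: kill_idl; first exact: ltnW.
have M0X n' (y : mpoly K R1) : y ^+ n' = 0 -> y = 0.
  elim: n' => [|n' IHn]; first by move/eqP; rewrite expr0 oner_eq0.
  by rewrite exprS => /mpoly_mulf_eq0[].
exact: M0X al0.
Qed.

End Strength.

(** * The ultraproduct *)

Record ultra := Ultra {
  uf :> (nat -> Prop) -> Prop;
  ultraS : forall P Q : nat -> Prop, (forall s, P s -> Q s) -> uf P -> uf Q;
  ultraI : forall P Q : nat -> Prop, uf P -> uf Q -> uf (fun s => P s /\ Q s);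
  ultraC : forall P : nat -> Prop, ~ uf P -> uf (fun s => ~ P s);
  ultra_ex : forall P : nat -> Prop, uf P -> exists s, P s;
  ultra_ge : forall m, uf (fun s => (m <= s)%N) }.

Lemma ultra_exists : exists _ : ultra, True.
Proof.
have [G [UG sub]] := ultraFilterLemma eventually_filter.
have PG : ProperFilter G := ultra_proper.
unshelve eexists; last by []; exists G.
- by move=> P Q PQ; apply: filterS.
- by move=> P Q; apply: filterI.
- by move=> P nP; have [] := in_ultra_setVsetC P UG.
- by move=> P; apply: filter_ex.
- by move=> m; apply: sub; exists m.
Qed.

Lemma ultraT (U : ultra) (P : nat -> Prop) : (forall s, P s) -> U P.
Proof. by move=> hP; apply: ultraS (ultra_ge U 0) => s _. Qed.

(** Otherwise a sequence of counterexamples, chosen wherever there is one, contradicts the first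
    hypothesis. *)
Lemma ultra_forall (U : ultra) (A : nat -> Type) (Q : forall s, A s -> Prop) :
  (forall x : forall s, A s, U (fun s => Q s (x s))) -> (forall s, A s) ->
  U (fun s => forall a, Q s a).
Proof.
move=> hQ x0; apply: contrapT => /ultraC nU.
have [x xH] : exists x : forall s, A s, forall s, ~ (forall a, Q s a) -> ~ Q s (x s).
  suff : forall s, exists a, ~ (forall a, Q s a) -> ~ Q s a.
    by move=> h; exists (fun s => projT1 (cid (h s))) => s; apply: (projT2 (cid (h s))).
  move=> s; have [hs|/existsNP[a na]] := pselect (forall a, Q s a); last by exists a.
  by exists (x0 s).
by have [s [h1 h2]] := ultra_ex (ultraI nU (hQ x)); apply: xH h1 h2.
Qed.

(** * Products of rings *)

Section ProductRing.
Variable A : nat -> comNzRingType.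
Definition prodR := forall s, A s.
HB.instance Definition _ := gen_eqMixin prodR.
HB.instance Definition _ := gen_choiceMixin prodR.

Let padd (f g : prodR) : prodR := fun s => f s + g s.
Let popp (f : prodR) : prodR := fun s => - f s.
Let pmul (f g : prodR) : prodR := fun s => f s * g s.

Fact paddA : associative padd.
Proof. by move=> f g h; apply/functional_extensionality_dep => s; apply: addrA. Qed.
Fact paddC : commutative padd.
Proof. by move=> f g; apply/functional_extensionality_dep => s; apply: addrC. Qed.
Fact padd0 : left_id (fun s => 0 : A s) padd.
Proof. by move=> f; apply/functional_extensionality_dep => s; apply: add0r. Qed.
Fact paddN : left_inverse (fun s => 0 : A s) popp padd.
Proof. by move=> f; apply/functional_extensionality_dep => s; apply: addNr. Qed.
HB.instance Definition _ := GRing.isZmodule.Build prodR paddA paddC padd0 paddN.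

Fact pmulA : associative pmul.
Proof. by move=> f g h; apply/functional_extensionality_dep => s; apply: mulrA. Qed.
Fact pmulC : commutative pmul.
Proof. by move=> f g; apply/functional_extensionality_dep => s; apply: mulrC. Qed.
Fact pmul1 : left_id (fun s => 1 : A s) pmul.
Proof. by move=> f; apply/functional_extensionality_dep => s; apply: mul1r. Qed.
Fact pmulD : left_distributive pmul padd.
Proof. by move=> f g h; apply/functional_extensionality_dep => s; apply: mulrDl. Qed.
Fact pone0 : (fun s => 1 : A s) != (0 : prodR).
Proof.
apply/eqP=> h; have /eqP := congr1 (fun f : prodR => f 0%N) h.
by rewrite oner_eq0.
Qed.
HB.instance Definition _ :=
  GRing.Zmodule_isComNzRing.Build prodR pmulA pmulC pmul1 pmulD pone0.

End ProductRing.

(** * The ultraproduct of fields *)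

Section UltraField.
Variables (U : ultra) (Kf : nat -> fieldType).
Local Notation PK := (prodR (fun s => Kf s)).

Definition nullK : {pred PK} := fun f => `[< U (fun s => f s = 0) >].

Fact nullK_ideal : idealr_closed nullK.
Proof.
split.
- by apply/asboolP/ultraT.
- by apply/asboolP => /ultra_ex[s] /eqP; rewrite oner_eq0.
- move=> a f g /asboolP hf /asboolP hg; apply/asboolP.
  apply: ultraS (ultraI hf hg) => s [fs gs].
  by rewrite -[LHS]/(a s * f s + g s) fs gs mulr0 addr0.
Qed.
HB.instance Definition _ := isIdealr.Build PK nullK nullK_ideal.

Definition Kst := {ideal_quot nullK}.
HB.instance Definition _ := GRing.ComNzRing.on Kst.

Definition piK : {rmorphism PK -> Kst} := GRing.RMorphism.clone _ _ (\pi_Kst)%qT _.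

Lemma piK_eq f g : piK f = piK g <-> U (fun s => f s = g s).
Proof.
split=> [/eqP|h].
  rewrite -Quotient.idealrBE => /asboolP; apply: ultraS => s /eqP.
  by rewrite -[X in X == _]/(f s - g s) subr_eq0 => /eqP.
apply/eqP; rewrite -Quotient.idealrBE; apply/asboolP; apply: ultraS h => s e.
by rewrite -[LHS]/(f s - g s) e subrr.
Qed.

Lemma piK_surj x : exists f, x = piK f.
Proof. by exists (repr x); rewrite /piK /= reprK. Qed.

Definition invK (x : Kst) : Kst := piK (fun s => (repr x s)^-1).

Lemma invK_pi f : invK (piK f) = piK (fun s => (f s)^-1).
Proof.
apply/piK_eq; have : piK (repr (piK f)) = piK f by rewrite {1}/piK /= reprK.
by move=> /piK_eq; apply: ultraS => s ->.
Qed.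

Fact mulVK (x : Kst) : x != 0 -> invK x * x = 1.
Proof.
have [f ->] := piK_surj x; rewrite invK_pi -rmorphM -(rmorph1 piK) => nz.
apply/piK_eq; have /ultraC : ~ U (fun s => f s = 0).
  by move=> h; case/eqP: nz; rewrite -(rmorph0 piK); apply/piK_eq.
by apply: ultraS => s /eqP nzs; rewrite -[LHS]/((f s)^-1 * f s) mulVf.
Qed.

Fact invK0 : invK 0 = 0.
Proof.
rewrite -(rmorph0 piK) invK_pi; apply/piK_eq; apply: ultraT => s.
exact: invr0.
Qed.

HB.instance Definition _ := GRing.ComNzRing_isField.Build Kst mulVK invK0.

End UltraField.

(** * The bounded degree ultraproduct of polynomial rings *)

Section UltraMPoly.
Variables (U : ultra) (Kf : nat -> fieldType) (N : nat -> nat).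
Let R s := mpoly (Kf s) (N s).
Let sgR s : {rmorphism R s -> {poly R s}} := msg (Kf s) (fun=> 1%N) (N s).
Let grR s : grading (sgR s) := msg_grading (Kf s) (fun=> 1%N) (N s).
Local Notation PR := (prodR R).

Definition bdd : {pred PR} := fun f => `[< exists M, forall s, (size (sgR s (f s)) <= M)%N >].

Fact bdd_subring : subring_closed bdd.
Proof.
split.
- apply/asboolP; exists 1%N => s.
  by rewrite -[X in sgR s X]/(1 : R s) rmorph1 size_poly1.
- move=> f g /asboolP[M hM] /asboolP[M' hM']; apply/asboolP; exists (maxn M M') => s.
  rewrite -[X in sgR s X]/(f s - g s) rmorphB (leq_trans (size_polyD _ _)) // size_polyN.
  by rewrite geq_max !leq_max hM hM' orbT.
- move=> f g /asboolP[M hM] /asboolP[M' hM']; apply/asboolP; exists (M + M')%N => s.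
  rewrite -[X in sgR s X]/(f s * g s) rmorphM (leq_trans (size_polyMleq _ _)) //.
  by rewrite (leq_trans (leq_pred _)) // leq_add.
Qed.
HB.instance Definition _ := GRing.isSubringClosed.Build PR bdd bdd_subring.

Record bseq := BSeq { bval : PR; _ : bval \in bdd }.
HB.instance Definition _ := [isSub for bval].
HB.instance Definition _ := [Choice of bseq by <:].
HB.instance Definition _ := [SubChoice_isSubComNzRing of bseq by <:].

Lemma bseqP (f : bseq) : exists M, forall s, (size (sgR s (bval f s)) <= M)%N.
Proof. by case: f => f h; apply/asboolP. Qed.

Definition mkb (f : PR) (h : exists M, forall s, (size (sgR s (f s)) <= M)%N) : bseq :=
  BSeq (asboolT h).

Definition nullS : {pred bseq} := fun f => `[< U (fun s => bval f s = 0) >].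

Fact nullS_ideal : idealr_closed nullS.
Proof.
split.
- by apply/asboolP/ultraT.
- by apply/asboolP => /ultra_ex[s] /eqP; rewrite oner_eq0.
- move=> a f g /asboolP hf /asboolP hg; apply/asboolP.
  apply: ultraS (ultraI hf hg) => s [fs gs].
  by rewrite -[LHS]/(bval a s * bval f s + bval g s) fs gs mulr0 addr0.
Qed.
HB.instance Definition _ := isIdealr.Build bseq nullS nullS_ideal.

Definition Sst := {ideal_quot nullS}.
HB.instance Definition _ := GRing.ComNzRing.on Sst.

Definition piS : {rmorphism bseq -> Sst} := GRing.RMorphism.clone _ _ (\pi_Sst)%qT _.

Lemma piS_eq f g : piS f = piS g <-> U (fun s => bval f s = bval g s).
Proof.
split=> [/eqP|h].
  rewrite -Quotient.idealrBE => /asboolP; apply: ultraS => s /eqP.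
  by rewrite -[X in X == _]/(bval f s - bval g s) subr_eq0 => /eqP.
apply/eqP; rewrite -Quotient.idealrBE; apply/asboolP; apply: ultraS h => s e.
by rewrite -[LHS]/(bval f s - bval g s) e subrr.
Qed.

Lemma piS_surj x : exists f, x = piS f.
Proof. by exists (repr x); rewrite /piS /= reprK. Qed.

Lemma Sst_dom (x y : Sst) : x * y = 0 -> x = 0 \/ y = 0.
Proof.
have [f ->] := piS_surj x; have [g ->] := piS_surj y.
rewrite -rmorphM -(rmorph0 piS) => /piS_eq hfg.
have [hf|/ultraC hf] := pselect (U (fun s => bval f s = 0)).
  by left; apply/piS_eq.
right; apply/piS_eq; apply: ultraS (ultraI hfg hf) => s [].
by rewrite -[X in X = _]/(bval f s * bval g s) => /mpoly_mulf_eq0[].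
Qed.

Definition bounded_map (phi : forall s, R s -> R s) := forall M, exists M',
  forall s f, (size (sgR s f) <= M)%N -> (size (sgR s (phi s f)) <= M')%N.

Lemma lift_bdd phi : bounded_map phi -> forall f : bseq,
  exists M, forall s, (size (sgR s (phi s (bval f s))) <= M)%N.
Proof.
by move=> hphi f; have [M hM] := bseqP f; have [M' hM'] := hphi M; exists M' => s; apply: hM'.
Qed.

Definition liftS phi (h : bounded_map phi) (x : Sst) : Sst := piS (mkb (lift_bdd h (repr x))).

Lemma liftSE phi (h : bounded_map phi) f : liftS h (piS f) = piS (mkb (lift_bdd h f)).
Proof.
apply/piS_eq; have : piS (repr (piS f)) = piS f by rewrite {1}/piS /= reprK.
by move=> /piS_eq; apply: ultraS => s /= ->.
Qed.

Lemma mkbE f h s : bval (@mkb f h) s = f s. Proof. by []. Qed.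
Lemma bvalD (f g : bseq) s : bval (f + g) s = bval f s + bval g s. Proof. by []. Qed.
Lemma bvalN (f : bseq) s : bval (- f) s = - bval f s. Proof. by []. Qed.
Lemma bvalM (f g : bseq) s : bval (f * g) s = bval f s * bval g s. Proof. by []. Qed.
Lemma bval0 s : bval 0 s = 0. Proof. by []. Qed.
Lemma bval1 s : bval 1 s = 1. Proof. by []. Qed.
Lemma bvalX (f : bseq) n s : bval (f ^+ n) s = bval f s ^+ n.
Proof. by elim: n => // n IH; rewrite !exprS bvalM IH. Qed.
Lemma bval_sum s (I : Type) (r : seq I) (P : pred I) (F : I -> bseq) :
  bval (\sum_(i <- r | P i) F i) s = \sum_(i <- r | P i) bval (F i) s.
Proof. by apply: (big_morph (fun f : bseq => bval f s)). Qed.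

Definition bvalE := (bvalD, bvalN, bvalM, bvalX, bval_sum, bval0, bval1, mkbE).

Local Notation K := (Kst U Kf).
Local Notation pK := (piK U Kf).

Fact constB_bdd (c : prodR (fun s => Kf s)) :
  exists M, forall s, (size (sgR s (mconst (N s) (c s))) <= M)%N.
Proof. by exists 1%N => s; apply/hom_size/hom_const. Qed.

Definition kapS (x : K) : Sst := piS (mkb (constB_bdd (repr x))).

Lemma kapSE c : kapS (pK c) = piS (mkb (constB_bdd c)).
Proof.
apply/piS_eq; have : pK (repr (pK c)) = pK c by rewrite {1}/piK /= reprK.
by move=> /piK_eq; apply: ultraS => s /= ->.
Qed.

Fact kapS_zmod : zmod_morphism kapS.
Proof.
move=> x y; have [a ->] := piK_surj x; have [b ->] := piK_surj y.
rewrite -rmorphB !kapSE -rmorphB; apply/piS_eq; apply: ultraT => s.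
rewrite !bvalE; exact: (rmorphB (mconst (N s)) (a s) (b s)).
Qed.

Fact kapS_monoid : monoid_morphism kapS.
Proof.
split=> [|x y].
  rewrite -(rmorph1 pK) kapSE -(rmorph1 piS); apply/piS_eq; apply: ultraT => s.
  rewrite !bvalE; exact: (rmorph1 (mconst (N s))).
have [a ->] := piK_surj x; have [b ->] := piK_surj y.
rewrite -rmorphM !kapSE -rmorphM; apply/piS_eq; apply: ultraT => s.
rewrite !bvalE; exact: (rmorphM (mconst (N s)) (a s) (b s)).
Qed.
HB.instance Definition _ := GRing.isZmodMorphism.Build K Sst kapS kapS_zmod.
HB.instance Definition _ := GRing.isMonoidMorphism.Build K Sst kapS kapS_monoid.

Fact hc_bounded k : bounded_map (fun s f => (sgR s f)`_k).
Proof. by move=> M; exists k.+1 => s f _; apply: hom_size; apply: (grR s).2. Qed.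

Definition hcS k := liftS (hc_bounded k).

Lemma hcSE k f : hcS k (piS f) = piS (mkb (lift_bdd (hc_bounded k) f)).
Proof. exact: liftSE. Qed.

Lemma hcS_bound x : exists M, forall k, (M <= k)%N -> hcS k x = 0.
Proof.
have [f ->] := piS_surj x; have [M hM] := bseqP f; exists M => k Mk.
rewrite hcSE -(rmorph0 piS); apply/piS_eq; apply: ultraT => s.
by rewrite !bvalE nth_default // (leq_trans (hM s)).
Qed.

Definition sgS (x : Sst) : {poly Sst} := \poly_(k < projT1 (cid (hcS_bound x))) hcS k x.

Lemma coef_sgS x k : (sgS x)`_k = hcS k x.
Proof.
rewrite coef_poly; case: ltnP => // Mk; apply/esym.
exact: (projT2 (cid (hcS_bound x))).
Qed.

Fact sgS_zmod : zmod_morphism sgS.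
Proof.
move=> x y; apply/polyP=> k; rewrite coefB !coef_sgS.
have [f ->] := piS_surj x; have [g ->] := piS_surj y.
rewrite -rmorphB !hcSE -rmorphB; apply/piS_eq; apply: ultraT => s.
by rewrite !bvalE rmorphB coefB.
Qed.

Fact sgS_monoid : monoid_morphism sgS.
Proof.
split=> [|x y]; apply/polyP=> k.
  rewrite coef_sgS -{1}(rmorph1 piS) hcSE coef1 -(rmorph_nat piS); apply/piS_eq.
  apply: ultraT => s; rewrite mkbE bval1 rmorph1 coef1.
  by case: (k == 0%N).
rewrite coefM coef_sgS; have [f ->] := piS_surj x; have [g ->] := piS_surj y.
under eq_bigr do rewrite !coef_sgS !hcSE -rmorphM.
rewrite -rmorph_sum -rmorphM hcSE; apply/piS_eq; apply: ultraT => s.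
rewrite !bvalE rmorphM coefM; apply: eq_bigr => i _.
by rewrite !bvalE.
Qed.
HB.instance Definition _ := GRing.isZmodMorphism.Build Sst {poly Sst} sgS sgS_zmod.
HB.instance Definition _ := GRing.isMonoidMorphism.Build Sst {poly Sst} sgS sgS_monoid.

Lemma hom_piS k f : hom sgS k (piS f) <-> U (fun s => hom (sgR s) k (bval f s)).
Proof.
split=> [/(coef_hom k)|h].
  rewrite coef_sgS hcSE eqxx mulr1n => /piS_eq; apply: ultraS => s.
  by rewrite !bvalE => <-; apply: (grR s).2.
apply: homP => l; rewrite coef_sgS hcSE -rmorphMn; apply/piS_eq; apply: ultraS h => s hs.
rewrite !bvalE (coef_hom _ hs); case: (l == k) => //.
Qed.

Lemma grS : grading sgS.
Proof.
split=> x; have [f ->] := piS_surj x; last first.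
  move=> k; rewrite coef_sgS hcSE; apply/hom_piS; apply: ultraT => s.
  by rewrite !bvalE; apply: (grR s).2.
have [M hM] := bseqP f.
have szM : (size (sgS (piS f)) <= M)%N.
  apply/leq_sizeP => k Mk; rewrite coef_sgS hcSE -(rmorph0 piS); apply/piS_eq.
  by apply: ultraT => s; rewrite !bvalE nth_default // (leq_trans (hM s)).
rewrite (horner_coef_wide _ szM).
under eq_bigr do rewrite expr1n mulr1 coef_sgS hcSE.
rewrite -rmorph_sum; apply/piS_eq; apply: ultraT => s; rewrite !bvalE.
by rewrite [RHS](sum_hc (grR s) (hM s)); apply: eq_bigr => i _; rewrite !bvalE.
Qed.

Lemma size_sgS f k : U (fun s => size (sgR s (bval f s)) <= k)%N -> (size (sgS (piS f)) <= k)%N.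
Proof.
move=> h; apply/leq_sizeP => l kl; rewrite coef_sgS hcSE -(rmorph0 piS); apply/piS_eq.
by apply: ultraS h => s hs; rewrite !bvalE nth_default // (leq_trans hs).
Qed.

Lemma hom_kapS c : hom sgS 0 (kapS c).
Proof.
by have [a ->] := piK_surj c; rewrite kapSE; apply/hom_piS; apply: ultraT => s; apply: hom_const.
Qed.

Lemma const_kapS f : U (fun s => exists c, bval f s = mconst (N s) c) ->
  exists c, piS f = kapS c.
Proof.
move=> h; have cP s : exists c, (exists c, bval f s = mconst (N s) c) -> bval f s = mconst (N s) c.
  by have [[c e]|n] := pselect (exists c, bval f s = mconst (N s) c); [exists c | exists 0].
exists (pK (fun s => projT1 (cid (cP s)))); rewrite kapSE; apply/piS_eq.
by apply: ultraS h => s /(projT2 (cid (cP s))).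
Qed.

Lemma hom0_kapS x : hom sgS 0 x -> exists c, x = kapS c.
Proof.
have [f ->] := piS_surj x => /hom_piS h; apply: const_kapS; apply: ultraS h => s.
move=> /(coef_hom 0); rewrite mulr1n => <-.
by eexists; apply: coef0_msg.
Qed.

Definition shift s (y : nat -> Kf s) : {rmorphism R s -> R s} :=
  mev (mconst (N s)) (fun i => mX (Kf s) (N s) i + mconst (N s) (y i)) (N s).

Lemma shift_top s y k f : hom (sgR s) k f -> top (sgR s) k (shift y f) f.
Proof.
move=> hf; rewrite -{2}(mev_id f); apply: mev_top hf => [c|i iN]; first exact: hom_const.
rewrite -[X in top _ _ _ X]addr0; apply: topD; first exact/top_hom/hom_X.
split; first exact: leq_trans (hom_size (hom_const _ _ _)) _.
by rewrite (coef_hom _ (hom_const _ _ _)).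
Qed.

Fact shift_bounded (y : forall s, nat -> Kf s) : bounded_map (fun s => shift (y s)).
Proof.
move=> M; exists M => s f hM; rewrite (sum_hc (grR s) hM) !rmorph_sum.
rewrite (leq_trans (size_sum _ _ _)) //; apply/bigmax_leqP=> k _.
by rewrite (leq_trans (shift_top (y s) ((grR s).2 f k)).1).
Qed.

Definition tauS y : Sst -> Sst := liftS (shift_bounded y).

Lemma tauSE y f : tauS y (piS f) = piS (mkb (lift_bdd (shift_bounded y) f)).
Proof. exact: liftSE. Qed.

Fact tauS_zmod y : zmod_morphism (tauS y).
Proof.
move=> x z; have [f ->] := piS_surj x; have [g ->] := piS_surj z.
rewrite -rmorphB !tauSE -rmorphB; apply/piS_eq; apply: ultraT => s.
by rewrite !bvalE rmorphB.
Qed.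

Fact tauS_monoid y : monoid_morphism (tauS y).
Proof.
split=> [|x z].
  rewrite -(rmorph1 piS) tauSE; apply/piS_eq; apply: ultraT => s.
  by rewrite !bvalE rmorph1.
have [f ->] := piS_surj x; have [g ->] := piS_surj z.
rewrite -rmorphM !tauSE -rmorphM; apply/piS_eq; apply: ultraT => s.
by rewrite !bvalE rmorphM.
Qed.
HB.instance Definition _ y := GRing.isZmodMorphism.Build Sst Sst (tauS y) (tauS_zmod y).
HB.instance Definition _ y := GRing.isMonoidMorphism.Build Sst Sst (tauS y) (tauS_monoid y).

Lemma tauS_kap y c : tauS y (kapS c) = kapS c.
Proof.
have [a ->] := piK_surj c; rewrite kapSE tauSE; apply/piS_eq; apply: ultraT => s.
by rewrite !bvalE /shift mev_const.
Qed.

Lemma tauS_low y k x : hom sgS k x -> (size (sgS (tauS y x - x)%R) <= k)%N.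
Proof.
have [f ->] := piS_surj x => /hom_piS h; rewrite tauSE -rmorphB; apply: size_sgS.
apply: ultraS h => s hs; rewrite !bvalE.
exact: size_top_sub (shift_top _ hs) hs.
Qed.

Hypothesis infKf : forall s (q : {poly Kf s}), q != 0 -> exists x, q.[x] != 0.

(** Almost every f_s is fixed by all translations, hence takes its value at 0 everywhere, and is
    constant because the field is infinite. *)
Lemma tauS_inv x : (forall y, tauS y x = x) -> exists c, x = kapS c.
Proof.
have [f ->] := piS_surj x => h; apply: const_kapS.
have : U (fun s => forall y : nat -> Kf s, shift y (bval f s) = bval f s).
  apply: (@ultra_forall U (fun s => nat -> Kf s) (fun s y => shift y (bval f s) = bval f s)).
    by move=> y; have := h y; rewrite tauSE => /piS_eq.
  by move=> s _; exact: 0.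
apply: ultraS => s hs; exists (mev idfun (fun=> 0) (N s) (bval f s)).
apply/eqP; rewrite -subr_eq0; apply: contrapT => /negP /(nonvanishing_point (@infKf s)) [a].
rewrite rmorphB mev_const /=; case/negP; rewrite subr_eq0; apply/eqP.
rewrite -{2}(hs a) /shift (mev_comp (phi' := idfun)) => [|c]; last by rewrite mev_const.
by apply: eq_mev => i iN /=; rewrite rmorphD mev_X // mev_const add0r.
Qed.

Fact pderiv_bounded (i : nat -> nat) : bounded_map (fun s f => @pderiv (Kf s) (N s) (i s) f).
Proof.
move=> M; exists M => s f hM; have [iN|Ni] := ltnP (i s) (N s); last first.
  by rewrite pderiv_ge // rmorph0 size_poly0.
apply/leq_sizeP => l Ml.
have -> : (sgR s (pderiv (i s) f))`_l = (sgR s (pderiv (i s) f) * 'X^1)`_(l + 1).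
  by rewrite coefMXn ltnNge leq_addl /= addnK.
by rewrite -(pderiv_msg (fun=> 1%N)) // coef_map_id0 ?pderiv0 // nth_default ?pderiv0 //
  (leq_trans hM) // (leq_trans Ml) // leq_addr.
Qed.

(** The index is a sequence: the variable may depend on s. A condition on all D x thus transfers to
    all partial derivatives of F_s for almost all s. *)
Definition DS i : Sst -> Sst := liftS (pderiv_bounded i).

Lemma DSE i f : DS i (piS f) = piS (mkb (lift_bdd (pderiv_bounded i) f)).
Proof. exact: liftSE. Qed.

Lemma DSD i x y : DS i (x + y) = DS i x + DS i y.
Proof.
have [f ->] := piS_surj x; have [g ->] := piS_surj y.
rewrite -rmorphD !DSE -rmorphD; apply/piS_eq; apply: ultraT => s.
by rewrite !bvalE pderivD.
Qed.

Lemma DSM i x y : DS i (x * y) = DS i x * y + x * DS i y.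
Proof.
have [f ->] := piS_surj x; have [g ->] := piS_surj y.
rewrite -rmorphM !DSE -!rmorphM -rmorphD; apply/piS_eq; apply: ultraT => s.
by rewrite !bvalE pderivM.
Qed.

Lemma DSC i j x : DS i (DS j x) = DS j (DS i x).
Proof.
have [f ->] := piS_surj x; rewrite !DSE; apply/piS_eq; apply: ultraT => s.
by rewrite !bvalE pderivC.
Qed.

Lemma DS_hom i k x : hom sgS k.+1 x -> hom sgS k (DS i x).
Proof.
have [f ->] := piS_surj x => /hom_piS h; rewrite DSE; apply/hom_piS; apply: ultraS h => s hs.
rewrite !bvalE; have [iN|Ni] := ltnP (i s) (N s); last by rewrite pderiv_ge //; apply: hom0.
by apply: (hom_pderiv (w := fun=> 1%N)); rewrite // addn1.
Qed.

Lemma DS_kap i c : DS i (kapS c) = 0.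
Proof.
have [a ->] := piK_surj c; rewrite kapSE DSE -(rmorph0 piS); apply/piS_eq; apply: ultraT => s.
by rewrite !bvalE pderiv_const.
Qed.

Lemma idl_piS r (t : nat -> bseq) (f : bseq) :
  idl r (fun j => piS (t j)) (piS f) -> U (fun s => idl r (fun j => bval (t j) s) (bval f s)).
Proof.
move=> [a aE]; have /boolp.choice[b bE] : forall j, exists b, a j = piS b by move=> j; apply: piS_surj.
move: aE; under eq_bigr do rewrite bE -rmorphM.
rewrite -rmorph_sum => /piS_eq; apply: ultraS => s ->; rewrite !bvalE.
by exists (fun j => bval (b j) s); apply: eq_bigr => j _; rewrite !bvalE.
Qed.

Variable p : nat.
Hypothesis charKf : forall s, p \in [pchar (Kf s)].
Hypothesis perfKf : forall s (c : Kf s), exists b, b ^+ p = c.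

Lemma DS_iter_p i x : iter p (DS i) x = 0.
Proof.
have [f ->] := piS_surj x.
have H m : exists2 g : bseq, iter m (DS i) (piS f) = piS g &
    forall s, bval g s = iter m (pderiv (i s)) (bval f s).
  elim: m => [|m [g gE gs]]; first by exists f.
  exists (mkb (lift_bdd (pderiv_bounded i) g)) => [|s]; first by rewrite /= gE DSE.
  by rewrite bvalE gs.
have [g -> gs] := H p; rewrite -(rmorph0 piS); apply/piS_eq; apply: ultraT => s.
by rewrite gs iter_pderiv_p.
Qed.

Lemma DS_poincare r (e : nat -> Sst) (u : nat -> nat) x :
  (forall j, (j < r)%N -> hom sgS (u j) (e j)) ->
  (forall i, idl r (fun j => e j ^+ p) (DS i x)) ->
  exists g, idl r (fun j => e j ^+ p) (x - g ^+ p).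
Proof.
move=> he hD; have [f fE] := piS_surj x; rewrite {}fE in hD *.
have /boolp.choice[t tE] : forall j, exists b, e j = piS b by move=> j; apply: piS_surj.
have het : U (fun s => forall j, (j < r)%N -> hom (sgR s) (u j) (bval (t j) s)).
  elim: r he {hD} => [|r IH] he; first exact: ultraT.
  have h1 := IH (fun j jr => he j (ltnW jr)).
  have := he r (ltnSn r); rewrite tE => /hom_piS h2; apply: ultraS (ultraI h1 h2) => s [k1 k2] j.
  by rewrite ltnS leq_eqVlt => /predU1P[->|] //; apply: k1.
have hDs : U (fun s => forall i, idl r (fun j => bval (t j) s ^+ p) (pderiv i (bval f s))).
  apply: (@ultra_forall U (fun=> nat) (fun s i =>
     idl r (fun j => bval (t j) s ^+ p) (pderiv i (bval f s)))) => [i|s]; last exact: 0%N.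
  have := hD i; rewrite DSE => hDi.
  have : idl r (fun j => piS (t j ^+ p)) (piS (mkb (lift_bdd (pderiv_bounded i) f))).
    by move: hDi => [a ->]; exists a; apply: eq_bigr => j _; rewrite rmorphXn tE.
  move=> /idl_piS; apply: ultraS => s; rewrite bvalE => -[a ->].
  by exists a; apply: eq_bigr => j _; rewrite bvalX.
have [M hM] := bseqP f.
(* Solutions are chosen where they exist, and 0 elsewhere, so that the sequence is bounded at every
   s. *)
pose good s (gb : R s * (nat -> R s)) := [/\ (size (sgR s gb.1) <= M)%N,
    forall j, (size (sgR s (gb.2 j)) <= M)%N &
    bval f s = gb.1 ^+ p + \sum_(j < r) gb.2 j * bval (t j) s ^+ p].
have gbP s : exists gb : R s * (nat -> R s), [/\ (size (sgR s gb.1) <= M)%N,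
    forall j, (size (sgR s (gb.2 j)) <= M)%N & (exists gb, good s gb) -> good s gb].
  have [[gb h]|n] := pselect (exists gb, good s gb).
    by exists gb; case: (h).
  by exists (0, fun=> 0); split=> //= *; rewrite rmorph0 size_poly0.
pose G s := projT1 (cid (gbP s)).
have Gb s : [/\ (size (sgR s (G s).1) <= M)%N,
    forall j, (size (sgR s ((G s).2 j)) <= M)%N & (exists gb, good s gb) -> good s (G s)].
  exact: projT2 (cid (gbP s)).
have g1 : exists M, forall s, (size (sgR s (G s).1) <= M)%N by exists M => s; case: (Gb s).
have g2 j : exists M, forall s, (size (sgR s ((G s).2 j)) <= M)%N by exists M => s; case: (Gb s).
exists (piS (@mkb (fun s => (G s).1) g1)), (fun j => piS (@mkb (fun s => (G s).2 j) (g2 j))).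
under eq_bigr do rewrite tE -rmorphXn -rmorphM.
rewrite -rmorph_sum -rmorphXn -rmorphB; apply/piS_eq.
apply: ultraS (ultraI het hDs) => s [hes hds].
have [g [b [h1 h2 h3]]] := poincare_hom (charKf s) (@perfKf s) hes (hM s) hds.
have [_ _ []] := Gb s; first by exists (g, b).
move=> _ _ fE; rewrite !bvalE fE addrC addKr.
by apply: eq_bigr => j _; rewrite !bvalE.
Qed.

Lemma prodR_nat (A : nat -> comNzRingType) n s : (n%:R : prodR A) s = n%:R.
Proof. by elim: n => // n IH; rewrite !mulrS -IH. Qed.

Lemma prodR_exp (A : nat -> comNzRingType) (f : prodR A) n s : (f ^+ n) s = f s ^+ n.
Proof. by elim: n => // n IH; rewrite !exprS -IH. Qed.

Lemma charKst : p \in [pchar K].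
Proof.
have pp : prime p := pcharf_prime (charKf 0%N).
rewrite inE /= pp -(rmorph_nat pK) -(rmorph0 pK) /=; apply/eqP/piK_eq.
by apply: ultraT => s; rewrite prodR_nat (pcharf0 (charKf s)).
Qed.

Lemma perfKst (c : K) : exists b, b ^+ p = c.
Proof.
have [f ->] := piK_surj c.
exists (pK (fun s => projT1 (cid (perfKf (f s))))); rewrite -rmorphXn; apply/piK_eq.
apply: ultraT => s; rewrite prodR_exp; exact: (projT2 (cid (perfKf (f s)))).
Qed.

(** Sequences whose terms differ at every s have different classes; this gives more elements of the
    ultraproduct than q can have roots. *)
Lemma infKst (q : {poly K}) : q != 0 -> exists x, q.[x] != 0.
Proof.
move=> nz_q; apply: contrapT => /forallNP nroot.
have uniqs s m : exists r : seq (Kf s), uniq r /\ size r = m.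
  elim: m => [|m [r [ur sr]]]; first by exists [::].
  have [|x nx] := @infKf s (\prod_(a <- r) ('X - a%:P)); first by rewrite monic_neq0 ?monic_prod_XsubC.
  exists (x :: r); rewrite /= sr; split=> //.
  by rewrite ur andbT -root_prod_XsubC.
pose r s := projT1 (cid (uniqs s (size q))).
have ur s : uniq (r s) := (projT2 (cid (uniqs s (size q)))).1.
have sr s : size (r s) = size q := (projT2 (cid (uniqs s (size q)))).2.
pose a k := pK (fun s => nth 0 (r s) k).
have : (size [seq a k | k <- iota 0 (size q)] < size q)%N.
  apply: max_poly_roots => //.
    by apply/allP=> x _; rewrite /root; apply/negPn/negP/nroot.
  rewrite map_inj_in_uniq ?iota_uniq // => k l; rewrite !mem_iota /= !add0n => kq lq.
  by move=> /piK_eq/ultra_ex[s] /eqP; rewrite nth_uniq ?sr ?ur // => /eqP.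
by rewrite size_map size_iota ltnn.
Qed.

End UltraMPoly.

(** * Bounds on the strength *)

Definition ofnat (T : nmodType) h (g : 'I_h -> T) (j : nat) : T := oapp g 0 (insub j).

Lemma ofnatE (T : nmodType) h (g : 'I_h -> T) (i : 'I_h) : ofnat g i = g i.
Proof. by rewrite /ofnat valK. Qed.

Lemma in_idealP (R : comNzRingType) h (g : 'I_h -> R) f : in_ideal g f <-> idl h (ofnat g) f.
Proof.
split=> [[a ->]|[a ->]].
  by exists (ofnat a); apply: eq_bigr => i _; rewrite !ofnatE.
by exists (fun i => a i); apply: eq_bigr => i _; rewrite ofnatE.
Qed.

Definition collapse (K : comNzRingType) N d m (F : mpoly K N) := exists (g : nat -> mpoly K N),
  (forall j, (j < m)%N -> exists e, [/\ (0 < e)%N, (e < d)%N & homog e (g j)]) /\ idl m g F.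

Lemma has_collapseP (K : comNzRingType) N d m (F : mpoly K N) :
  has_collapse d m F <-> collapse d m F.
Proof.
split=> [[g [hg /in_idealP gF]]|[g [hg [a ->]]]].
  by exists (ofnat g); split=> // j jm; have := hg (Ordinal jm); rewrite -(ofnatE g).
exists (fun i => g i); split=> [i|]; first exact: hg.
by exists (fun i => a i).
Qed.

Lemma homog0 (K : comNzRingType) N e : homog e (0 : mpoly K N).
Proof. by apply/homogP; apply: hom0. Qed.

(** The list is padded with 0, which counts as a form of degree 1; hence the condition 1 < d. *)
Lemma collapse_le (K : comNzRingType) N d m m' (F : mpoly K N) :
  (1 < d)%N -> (m <= m')%N -> collapse d m F -> collapse d m' F.
Proof.
move=> d1 mm' [g [hg gF]]; exists (fun j => if (j < m)%N then g j else 0); split=> [j jm'|].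
  by case: ifP => jm; [apply: hg | exists 1%N; split=> //; apply: homog0].
apply: idl_sub gF => j jm; have := idl_gen (fun j => if (j < m)%N then g j else 0) (leq_trans jm mm').
by rewrite jm.
Qed.

Lemma strength_ge_le (K : comNzRingType) N d s s' (F : mpoly K N) :
  (1 < d)%N -> (s <= s')%N -> strength_ge d s' F -> strength_ge d s F.
Proof. by move=> d1 ss' nF /has_collapseP/(collapse_le d1 ss')/has_collapseP. Qed.

Lemma pderiv_in_DF (K : comNzRingType) N (F : mpoly K N) i : in_DF F (pderiv i F).
Proof.
exists (fun j : 'I_N => (i == j :> nat)%:R); have [iN|Ni] := ltnP i N; last first.
  rewrite pderiv_ge // big1 // => j _; rewrite gtn_eqF ?rmorph0 ?mul0r //.
  exact: leq_trans (ltn_ord j) Ni.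
rewrite (bigD1 (Ordinal iN)) //= eqxx rmorph1 mul1r big1 ?addr0 // => j.
by rewrite -val_eqE /= eq_sym => /negPf->; rewrite rmorph0 mul0r.
Qed.

(** * From sequences of forms to the ultraproduct *)

Section CounterExamples.
Variables (U : ultra) (Kf : nat -> fieldType) (N : nat -> nat).
Local Notation pS := (piS U Kf N).
Local Notation sS := (@sgS U Kf N).

(** A sum of m products yields m generators, one factor of each. The number m precedes the
    representative, as the induction changes representatives. *)
Lemma dec_collapse k x : dec sS k x ->
  exists m, forall f, x = pS f -> U (fun s => collapse k m (bval f s)).
Proof.
elim=> [|{}x a b i _ [m IH] /andP[i0 ik] ha hb].
  exists 0%N => f; rewrite -(rmorph0 pS) => /piS_eq; apply: ultraS => s <-.
  by exists (fun=> 0); split=> //; apply: idl0.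
have [f' xE] := piS_surj x; have [a' aE] := piS_surj a; have [b' bE] := piS_surj b.
exists m.+1 => f; rewrite xE aE bE -rmorphM -rmorphD => /piS_eq hf.
rewrite aE in ha; move: (IH f' xE) ha => hf' /hom_piS ha.
apply: ultraS (ultraI hf (ultraI hf' ha)) => s [<- [[g [hg gF]] has]].
exists (add_last m g (bval a' s)); rewrite /add_last; split=> [j|].
  rewrite ltnS leq_eqVlt => /predU1P[->|jm]; last by rewrite (ltn_eqF jm); apply: hg.
  by rewrite eqxx; exists i; split=> //; apply/homogP.
rewrite !bvalE; apply: idlD.
  apply: idl_sub gF => j jm; have := idl_gen (add_last m g (bval a' s)) (ltnW jm : j < m.+1)%N.
  by rewrite /add_last (ltn_eqF jm).
rewrite mulrC; apply: idlMl; have := idl_gen (add_last m g (bval a' s)) (ltnSn m).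
by rewrite /add_last eqxx.
Qed.

Lemma ultra_pigeonhole (phi : nat -> nat) d : (forall s, (phi s < d)%N) ->
  exists e, U (fun s => phi s = e).
Proof.
move=> h; have : U (fun s => (phi s < d)%N) by apply: ultraT.
elim: d {h} => [|d IH] h; first by have [] := ultra_ex h.
have [hd|/ultraC hd] := pselect (U (fun s => phi s = d)); first by exists d.
apply: IH; apply: ultraS (ultraI h hd) => s [].
by rewrite ltnS leq_eqVlt => /predU1P[].
Qed.

Hypothesis infKf : forall s (q : {poly Kf s}), q != 0 -> exists x, q.[x] != 0.
Variable p : nat.
Hypothesis charKf : forall s, p \in [pchar (Kf s)].
Hypothesis perfKf : forall s (c : Kf s), exists b, b ^+ p = c.
Variables (h d : nat) (F : forall s, mpoly (Kf s) (N s)) (g : forall s, nat -> mpoly (Kf s) (N s)).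
Hypothesis d_gt1 : (1 < d)%N.
Hypothesis hF : forall s, homog d (F s).
Hypothesis hg : forall s j, (j < h)%N -> exists e, [/\ (0 < e)%N, (e < d)%N & homog e (g s j)].
Hypothesis DF : forall s i, idl h (g s) (pderiv i (F s)).

Lemma bounded_strength : exists s, collapse d s (F s).
Proof.
have sgF : exists M, forall s, (size (msg (Kf s) (fun=> 1%N) (N s) (F s)) <= M)%N.
  by exists d.+1 => s; apply: hom_size; apply/homogP.
pose f := mkb sgF; pose x : Sst U Kf N := pS f.
have hx : hom sS d x by apply/hom_piS; apply: ultraT => s; apply/homogP.
(* If the class is decomposable, one m serves for almost all s, hence for some s at least m. *)
have [/dec_collapse[m /(_ f erefl) hm]|nx] := pselect (dec sS d x).
  have [s [ms cs]] := ultra_ex (ultraI (ultra_ge U m) hm).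
  by exists s; apply: collapse_le ms cs.
exfalso.
have degP s j : exists e, (e < d)%N /\ ((j < h)%N -> (0 < e)%N /\ homog e (g s j)).
  have [/(hg s)[e [e0 ed he]]|_] := ltnP j h; first by exists e.
  by exists 0%N; split=> //; apply: ltnW.
pose dg s j := projT1 (cid (degP s j)).
have dgP s j : (dg s j < d)%N /\ ((j < h)%N -> (0 < dg s j)%N /\ homog (dg s j) (g s j)).
  exact: (projT2 (cid (degP s j))).
(* The degrees of the generators may vary with s, but take finitely many values. *)
have /boolp.choice[e eP] : forall j, exists e, U (fun s => dg s j = e).
  by move=> j; apply: (@ultra_pigeonhole _ d) => s; apply: (dgP s j).1.
have tb j : exists M, forall s, (size (msg (Kf s) (fun=> 1%N) (N s)
    (if (j < h)%N then g s j else 0%R)) <= M)%N.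
  exists d => s; case: ltnP => [jh|_]; last by rewrite rmorph0 size_poly0.
  have [ltd /(_ jh)[_ /homogP/hom_size]] := dgP s j; by move=> /leq_trans; apply.
have key := (@strong_all (Kst U Kf) (Sst U Kf N) (@kapS U Kf N) p (charKst U charKf) 
  (@perfKst U Kf p perfKf) (@infKst U Kf infKf) (@Sst_dom U Kf N) sS (@grS U Kf N) (@hom_kapS U Kf N) (@hom0_kapS U Kf N)
  _ _ (@tauS_kap U Kf N) (@tauS_low U Kf N) (@tauS_inv U Kf N infKf)
  _ _ (@DSD U Kf N) (@DSM U Kf N) (@DSC U Kf N) (@DS_iter_p U Kf N p charKf) (@DS_hom U Kf N)
  (@DS_kap U Kf N) (@DS_poincare U Kf N p charKf perfKf) d (ltnW d_gt1)).
apply: (key x hx nx h (fun j => pS (mkb (tb j))) e).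
  move=> j jh; split.
    have [s es] := ultra_ex (eP j); by rewrite -es; apply: ((dgP s j).2 jh).1.
  apply/hom_piS; apply: ultraS (eP j) => s <-; rewrite mkbE jh.
  by apply/homogP; apply: ((dgP s j).2 jh).2.
move=> i; rewrite DSE.
have aP s : exists a : nat -> mpoly (Kf s) (N s),
    (forall j, (size (msg (Kf s) (fun=> 1%N) (N s) (a j)) <= d)%N) /\
    pderiv (i s) (F s) = \sum_(j < h) a j * g s j.
  have hgs j : (j < h)%N -> hom (msg (Kf s) (fun=> 1%N) (N s)) (dg s j) (g s j).
    by move=> jh; apply/homogP; apply: ((dgP s j).2 jh).2.
  have sz : (size (msg (Kf s) (fun=> 1%N) (N s) (pderiv (i s) (F s))) <= d)%N.
    have [iN|Ni] := ltnP (i s) (N s); last by rewrite pderiv_ge // rmorph0 size_poly0.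
    rewrite -(prednK (ltnW d_gt1)); apply: hom_size; apply: (hom_pderiv (w := fun=> 1%N)) => //.
    by rewrite addn1 prednK ?(ltnW d_gt1) //; apply/homogP.
  have [a ha aE] := idl_trunc (msg_grading (Kf s) (fun=> 1%N) (N s)) hgs sz (DF s (i s)).
  by exists a.
pose a s := projT1 (cid (aP s)).
have ab j : exists M, forall s, (size (msg (Kf s) (fun=> 1%N) (N s) (a s j)) <= M)%N.
  by exists d => s; apply: (projT2 (cid (aP s))).1.
exists (fun j => pS (@mkb _ _ (fun s => a s j) (ab j))).
under eq_bigr do rewrite -rmorphM; rewrite -rmorph_sum; apply/piS_eq; apply: ultraT => s.
rewrite mkbE [LHS](projT2 (cid (aP s))).2 bval_sum; apply: eq_bigr => j _.
by rewrite bvalM !mkbE ltn_ord.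
Qed.

End CounterExamples.

(** Field and number of variables are bundled so that a sequence of counterexamples can be chosen at
    once. *)
Record instance := Instance {
  iK : closedFieldType; iN : nat; iF : mpoly iK iN; ig : nat -> mpoly iK iN }.

Definition counterexample h d p s (x : instance) := [/\ p \in [pchar (iK x)], homog d (iF x),
  ~ collapse d s (iF x),
  forall j, (j < h)%N -> exists e, [/\ (0 < e)%N, (e < d)%N & homog e (ig x j)] &
  forall i, idl h (ig x) (pderiv i (iF x))].

Lemma bounded_pchar h d p : (1 < d)%N -> exists s, forall x, ~ counterexample h d p s x.
Proof.
move=> d_gt1; apply: contrapT => /forallNP H.
have /boolp.choice[X XP] : forall s, exists x, counterexample h d p s x.
  by move=> s; apply: contrapT => /forallNP; apply: H.
have [U _] := ultra_exists.
have chX s : p \in [pchar (iK (X s))] by case: (XP s).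
have p_gt0 : (0 < p)%N := prime_gt0 (pcharf_prime (chX 0%N)).
have [|||||s cs] := @bounded_strength U (fun s => iK (X s)) (fun s => iN (X s)) _ p chX _ h d
   (fun s => iF (X s)) (fun s => ig (X s)) d_gt1.
- by move=> s q /closed_nonrootP.
- move=> s c; have /closed_rootP[b] : size ('X^p - c%:P : {poly iK (X s)}) != 1%N.
    by rewrite size_XnsubC // eqSS -lt0n.
  by rewrite /root hornerD hornerN hornerC hornerXn subr_eq0 => /eqP; exists b.
- by move=> s; case: (XP s).
- by move=> s; case: (XP s).
- by move=> s; case: (XP s).
by case: (XP s).
Qed.

Lemma bounded_all h d : (1 < d)%N -> exists s,
  forall (K : closedFieldType) N (F : mpoly K N) (g : 'I_h -> mpoly K N),
    homog d F -> strength_ge d s F ->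
    (forall i, exists e, [/\ (0 < e)%N, (e < d)%N & homog e (g i)]) ->
    ~ (forall i, in_ideal g (pderiv i F)).
Proof.
move=> d_gt1; have /boolp.choice[b bP] := fun p => bounded_pchar h p d_gt1.
(* If d is nonzero in K, Euler's formula gives an h-collapse. Otherwise the characteristic divides
   d, so it occurs in the sum. *)
exists (h + \sum_(p < d.+1) b p)%N => K N F g hF sF hg DF.
have [d0|nz_d] := eqVneq (d%:R : K) 0; last first.
  have /(strength_ge_le d_gt1 (leq_addr _ _)) := sF; apply; exists g; split=> //.
  apply/in_idealP; rewrite -[F]mul1r -(rmorph1 (mconst N)) -(mulVf nz_d) rmorphM -mulrA.
  apply: idlMl; rewrite rmorph_nat mulr_natl -(euler hF).
  by apply: idl_sum => i _; apply/idlMl/in_idealP.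
have [|p pK] := @natf0_pchar K d (ltnW d_gt1); first by rewrite d0.
have pd : (p < d.+1)%N.
  by rewrite ltnS dvdn_leq ?(ltnW d_gt1) // (dvdn_pcharf pK) d0.
apply: (bP p (@Instance K N F (ofnat g))); split=> //=.
- move=> /has_collapseP; apply: (strength_ge_le d_gt1 _ sF).
  by rewrite (bigD1 (Ordinal pd)) //= addnCA leq_addr.
- by move=> j jh; have := hg (Ordinal jh); rewrite -(ofnatE g).
by move=> i; apply/in_idealP.
Qed.

Lemma leq_sum_ord n m (f : nat -> nat) : (n <= m)%N -> (\sum_(i < n) f i <= \sum_(i < m) f i)%N.
Proof. by move=> /subnKC <-; rewrite big_split_ord leq_addr. Qed.

Theorem theoremF :
  exists Phi : nat -> nat -> nat,
    ascending2 Phi /\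
    forall (h d : nat), (0 < h)%N -> (0 < d)%N ->
    forall (K : closedFieldType) (N : nat) (F : mpoly K N),
      F != 0 -> homog d F -> strength_ge d (Phi h d) F ->
      forall g : 'I_h -> mpoly K N,
        (forall i, exists e : nat, [/\ (0 < e)%N, (e <= d - 1)%N & homog e (g i)]) ->
        ~ (forall v : mpoly K N, in_DF F v -> in_ideal g v).
Proof.
have /boolp.choice[b bP] : forall hd : nat * nat, exists s, (1 < hd.2)%N ->
  forall (K : closedFieldType) N (F : mpoly K N) (g : 'I_hd.1 -> mpoly K N),
    homog hd.2 F -> strength_ge hd.2 s F ->
    (forall i, exists e, [/\ (0 < e)%N, (e < hd.2)%N & homog e (g i)]) ->
    ~ (forall i, in_ideal g (pderiv i F)).
  move=> [h d] /=; have [/(bounded_all h)[s sP]|_] := ltnP 1 d; last by exists 0%N.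
  by exists s.
(* Summing over all smaller arguments makes the bound ascending. *)
exists (fun h d => \sum_(i < h.+1) \sum_(j < d.+1) b (i : nat, j : nat))%N; split.
  move=> h h' d d' _ _ hh' dd'.
  apply: leq_trans (leq_sum_ord (fun i => \sum_(j < d'.+1) b (i, j : nat))%N (hh' : h < h'.+1)%N).
  by apply: leq_sum => i _; apply: (leq_sum_ord (fun j => b (i : nat, j))).
move=> h d h_gt0 d_gt0 K N F _ hF sF g hg DF.
(* For d = 1 no positive degree is at most d - 1, and h > 0 provides a generator. *)
have d_gt1 : (1 < d)%N.
  have [e [e0 ed _]] := hg (Ordinal h_gt0); rewrite -subn_gt0; exact: leq_trans ed.
apply: (bP (h, d) d_gt1 K N F g hF) => /= [|i|i].
- apply: (strength_ge_le d_gt1 _ sF).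
  by rewrite big_ord_recr /= (leq_trans _ (leq_addl _ _)) // big_ord_recr leq_addl.
- by have [e [e0 ed he]] := hg i; exists e; rewrite -(subnK d_gt0) addn1 ltnS.
by apply: DF; apply: pderiv_in_DF.
Qed.
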